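(* Let $\Omega$ be a Polish space with its Borel sigma algebra $\mathcal F$, and let $\mathcal P\subseteq\mathcal M_1$ be nonempty, convex and weakly compact. Then $\mathcal P_{\mathrm{eff}}=\mathrm{sol}(\mathcal P)$, and thus for any $\mathsf Q\in\mathcal M_1$, $$\min_{\mathsf S\in\mathcal P_{\mathrm{eff}}}H(\mathsf Q\mid\mathsf S)=\min_{\mathsf P\in\mathcal P}H(\mathsf Q\mid\mathsf P).$$ Thus, for nonempty convex $\mathcal Q\subseteq\mathcal M_1$, the following two strong duality results hold with $\mathcal P$ in place of $\mathcal P_{\mathrm{eff}}$ on the right-hand side: (a) if there exist a joint information projection $(\mathsf P^*,\mathsf Q^* )$ and a random variable $X^*$ that is a $\mathsf P^*$-version of $d\mathsf Q^*/d\mathsf P^*$ with $\mathbb E_{\mathsf Q}[\log X^*]\ge\inf_{\mathsf R\in\mathcal Q}H(\mathsf R\mid\mathsf P^* )$ for each $\mathsf Q\in\mathcal Q$, then the corresponding e-variable $X^*$ is a GROW e-variable, which satisfies $$\mathsf G=\sup_{X\in\mathcal E}\inf_{\mathsf Q\in\mathcal Q}\mathbb E_{\mathsf Q}[\log X]=\inf_{\mathsf Q\in\mathcal Q}\mathbb E_{\mathsf Q}[\log X^*]=\inf_{\mathsf Q\in\mathcal Q}H(\mathsf Q\mid\mathsf P^* )=\inf_{\mathsf Q\in\mathcal Q}\min_{\mathsf P\in\mathcal P}H(\mathsf Q\mid\mathsf P),$$ and if moreover $\mathsf Q^*\in\mathcal Q$, then $X^*$ is the $\mathsf P^*$-a.s.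 unique GROW e-variable; (b) if $\mathcal Q$ is setwise compact, then $\mathsf G=\mathsf G_b=\min_{\mathsf Q\in\mathcal Q}\min_{\mathsf P\in\mathcal P}H(\mathsf Q\mid\mathsf P)$.
   Context: $\mathcal M$, $\mathcal M_+$, $\mathcal M_1$ are the sets of finite signed (countably additive) measures, finite nonnegative measures, and probability measures on $\mathcal F$. ''Weakly compact'' refers to the usual weak topology (integrals of bounded continuous functions); ''setwise compact'' means compact for $\sigma(\mathcal M,\mathcal B_b)$, where $\mathcal B_b$ is the set of bounded measurable functions $\Omega\to\mathbb R$. The solid hull is $\mathrm{sol}(\mathcal P)=\{\mathsf S\in\mathcal M_+:\mathsf S\le\mathsf P\text{ (setwise) for some }\mathsf P\in\mathcal P\}$. An e-variable for $\mathcal P$ is a measurable $X:\Omega\to[0,\infty]$ with $\int X\,d\mathsf P\le1$ for all $\mathsf P\in\mathcal P$; $\mathcal E$ is the set of e-variables, $\mathcal E_b$ the subset of those bounded from above. The effective null is $\mathcal P_{\mathrm{eff}}=\{\mathsf P\in\mathcal M_+:\int X\,d\mathsf P\le1\text{ for all }X\in\mathcal E\}$. $\mathsf G=\sup_{X\in\mathcal E}\inf_{\mathsf Q\in\mathcal Q}\mathbb E_{\mathsf Q}[\log X]$ and $\mathsf G_b=\sup_{X\in\mathcal E_b}\inf_{\mathsf Q\in\mathcal Q}\mathbb E_{\mathsf Q}[\log X]$. A GROW e-variable is an $X\in\mathcal E$ with $\inf_{\mathsf Q\in\mathcal Q}\mathbb E_{\mathsf Q}[\log X]=\mathsf G$.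 Conventions: $\log0=-\infty$, $\log\infty=\infty$; $\mathbb E_{\mathsf Q}[\log X]$ is the usual difference of positive and negative parts if $\mathbb E_{\mathsf Q}[(\log X)^-]<\infty$, and $=-\infty$ if $\mathbb E_{\mathsf Q}[(\log X)^-]=\infty$. For $\mathsf Q\in\mathcal M_1$, $\mathsf P\in\mathcal M_+$: $H(\mathsf Q\mid\mathsf P)=\int\log(d\mathsf Q/d\mathsf P)\,d\mathsf Q$ if $\mathsf Q\ll\mathsf P$ and $=\infty$ otherwise. Reverse information projection (RIPr): for $\mathsf Q\in\mathcal M_1$ the numeraire $X^{\mathrm{num}}$ is the log-optimal e-variable for $\mathcal P$ against $\mathsf Q$: the ($\mathsf Q$-a.s. unique, known to exist) e-variable that is $\mathsf Q$-a.s. strictly positive and satisfies $\mathbb E_{\mathsf Q}[X/X^{\mathrm{num}}]\le1$ for all $X\in\mathcal E$ (with $x/\infty=0$ for $x<\infty$ and $\infty/\infty=1$). The RIPr of $\mathsf Q$ onto $\mathcal P_{\mathrm{eff}}$ is the sub-probability measure with $\mathsf Q$-density $1/X^{\mathrm{num}}$; it belongs to $\mathcal P_{\mathrm{eff}}$. Generalized I-projection (GIPr): for a probability measure $\mathsf P$ and convex $\mathcal Q$ with $\inf_{\mathsf Q\in\mathcal Q}H(\mathsf Q\mid\mathsf P)<\infty$, the GIPr of $\mathsf P$ onto $\mathcal Q$ is the unique probability measure $\mathsf Q'$ (known to exist, not necessarily in $\mathcal Q$) with $H(\mathsf Q\mid\mathsf Q')+\inf_{\mathsf R\in\mathcal Q}H(\mathsf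 R\mid\mathsf P)\le H(\mathsf Q\mid\mathsf P)$ for all $\mathsf Q\in\mathcal Q$. For a nonzero sub-probability $\mathsf P$, the GIPr is that of $\mathsf P/\mathsf P(\Omega)$. It always lies in $\overline{\mathcal Q}^I=\{\mathsf R\in\mathcal M_1:\inf_{\mathsf Q\in\mathcal Q}H(\mathsf Q\mid\mathsf R)=0\}$. Joint information projection: a pair $(\mathsf P^*,\mathsf Q^* )\in\mathcal M_+\times\mathcal M_1$ such that (i) $\mathsf P^*\in\mathcal P_{\mathrm{eff}}$ is the RIPr of $\mathsf Q^*$ onto $\mathcal P_{\mathrm{eff}}$; (ii) $\inf_{\mathsf Q\in\mathcal Q}H(\mathsf Q\mid\mathsf P^* )<\infty$ and $\mathsf Q^*\in\overline{\mathcal Q}^I$ is the GIPr of $\mathsf P^*$ onto $\mathcal Q$. A ''$\mathsf P^*$-version'' of $d\mathsf Q^*/d\mathsf P^*$ is a $[0,\infty]$-valued measurable function $\mathsf P^*$-a.s. equal to this density.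
   Formalization: In (a), the random variable X* is additionally assumed to be an e-variable for P; an arbitrary P*-version of dQ*/dP* satisfying the inequality need not be one, and the claim then fails. *)

(* Defs.v *)
From HB Require Import structures.
From mathcomp Require Import all_boot all_order all_algebra.
From mathcomp Require Import all_classical all_reals all_analysis measurable_realfun.

Set Implicit Arguments.
Unset Strict Implicit.
Unset Printing Implicit Defensive.

Import Order.TTheory GRing.Theory Num.Theory.
Import numFieldNormedType.Exports.

Local Open Scope classical_set_scope.
Local Open Scope ring_scope.
Local Open Scope ereal_scope.
Local Open Scope charge_scope.

(* A topology is Polish when it is separable and induced by some complete
   metric; the metric is not part of the data. *)
Definition polish (R : realType) (T : topologicalType) : Prop :=
  (exists2 D : set T, countable D & dense D) /\
  (exists (M : metricType R) (f : T -> M) (g : M -> T),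
    [/\ cancel f g, cancel g f, continuous f, continuous g &
        forall F : set_system M, ProperFilter F -> cauchy F -> exists x : M, F --> x]).

Notation borelType T := (g_sigma_algebraType (@open T)).

Section prelim.
Context {d : measure_display} {T : measurableType d} {R : realType}.
Implicit Types (A : set (probability T R)).

(* Inhabitants of [probability T R] are functions on all of [set T], and may
   differ outside the sigma-algebra: the mixture is only asked to have a
   representative in [A]. *)
Definition convex_probs A : Prop :=
  forall P Q : probability T R, A P -> A Q ->
  forall t : R, (0 <= t <= 1)%R ->
  exists2 S : probability T R, A S &
    forall B, measurable B -> S B = t%:E * P B + (1 - t)%:E * Q B.

(* The coarsest topology on probability measures that makes P |-> \int f dP
   continuous for every f in F: the codomain carries the product topology.
   It is the trace on M_1 of sigma(M, F); compactness of a subset of M_1 is the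
   same in both. *)
Definition probs_topology (F : set (T -> R)) : topologicalType :=
  initial_topology
    (fun P : probability T R =>
       (fun f : F => Rintegral P setT (set_val f)) : {ptws F -> R}).

Definition setwise_compact A : Prop :=
  compact (A : set (probs_topology
    [set f : T -> R | measurable_fun setT f /\
       exists M : R, forall x, (`|f x| <= M)%R])).

Definition is_minimum (X : Type) (A : set X) (f : X -> \bar R) (m : \bar R) :=
  (exists2 x, A x & f x = m) /\ (forall x, A x -> m <= f x).

End prelim.

Definition weakly_compact (R : realType) (T : ptopologicalType)
    (A : set (probability (borelType T) R)) : Prop :=
  compact (A : set (probs_topology
    [set f : borelType T -> R | continuous (f : T -> R) /\
       exists M : R, forall x, (`|f x| <= M)%R])).

Section evalues.
Context {d : measure_display} {T : measurableType d} {R : realType}.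
Local Notation M1 := (probability T R).
Local Notation Mp := {finite_measure set T -> \bar R}.
Implicit Types (PP QQ : set M1) (P Q : M1) (S : Mp) (X Y : T -> \bar R).

Definition sol PP : set Mp :=
  [set S : Mp | exists2 P : M1, PP P & forall B, measurable B -> S B <= P B].

Definition evariable PP : set (T -> \bar R) :=
  [set X : T -> \bar R | [/\ measurable_fun setT X, (forall x, 0 <= X x) &
               forall P : M1, PP P -> \int[P]_x X x <= 1]].

Definition bounded_evariable PP : set (T -> \bar R) :=
  [set X : T -> \bar R | evariable PP X /\ exists M : R, forall x, X x <= M%:E].

Definition Peff PP : set Mp :=
  [set S : Mp | forall X, evariable PP X -> \int[S]_x X x <= 1].

(* [\int] is the integral of the positive part minus that of the negative part,
   and +oo - +oo = -oo in [\bar R]: so the value is -oo whenever the negative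
   part has infinite integral. Also [lne 0 = -oo] and [lne +oo = +oo]. *)
Definition Elog Q X : \bar R := \int[Q]_x lne (X x).

Definition relent Q S : \bar R :=
  if `[< Q `<< S >] then
    \int[Q]_x lne (('d (charge_of_finite_measure Q) '/d S) x)
  else +oo.

Definition inf_relent QQ S : \bar R := ereal_inf [set relent Q S | Q in QQ].

Definition min_relent PP Q : \bar R := ereal_inf [set relent Q P | P in PP].

Definition inf_Elog QQ X : \bar R := ereal_inf [set Elog Q X | Q in QQ].

Definition G_val PP QQ : \bar R :=
  ereal_sup [set inf_Elog QQ X | X in evariable PP].

Definition Gb_val PP QQ : \bar R :=
  ereal_sup [set inf_Elog QQ X | X in bounded_evariable PP].

Definition is_GROW PP QQ X : Prop :=
  evariable PP X /\ inf_Elog QQ X = G_val PP QQ.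

(* In [\bar R], [x / +oo = 0] holds also for [x = +oo]. *)
Definition eratio (x y : \bar R) : \bar R :=
  if (x == +oo) && (y == +oo) then 1 else x / y.

Definition is_numeraire PP Q X : Prop :=
  [/\ evariable PP X, {ae Q, forall x, 0 < X x} &
      forall Y, evariable PP Y -> \int[Q]_x eratio (Y x) (X x) <= 1].

Definition is_RIPr PP Q S : Prop :=
  exists2 X, is_numeraire PP Q X &
    forall B, measurable B -> S B = \int[Q]_(x in B) (X x)^-1.

Definition I_closure QQ : set M1 := [set P : M1 | inf_relent QQ P = 0].

Definition is_GIPr_prob QQ P Q' : Prop :=
  inf_relent QQ P < +oo /\
  forall Q : M1, QQ Q -> relent Q Q' + inf_relent QQ P <= relent Q P.

(* [mnormalize S point] is S / S(T); the default [point] is only used when S is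
   zero, which is excluded. *)
Definition is_GIPr QQ S Q' : Prop :=
  0 < S setT /\ is_GIPr_prob QQ (mnormalize S point) Q'.

Definition joint_projection PP QQ S Q : Prop :=
  [/\ Peff PP S, is_RIPr PP Q S, inf_relent QQ S < +oo, I_closure QQ Q &
      is_GIPr QQ S Q].

Definition is_density_version Q S X : Prop :=
  [/\ measurable_fun setT X, (forall x, 0 <= X x) &
      ae_eq S setT X ('d (charge_of_finite_measure Q) '/d S)].

End evalues.

(* Main.v *)
Require Import Defs.
From HB Require Import structures.
From mathcomp Require Import all_boot all_order all_algebra.
From mathcomp Require Import all_classical all_reals all_analysis measurable_realfun.
From mathcomp Require Import ring lra.

Import Order.TTheory GRing.Theory Num.Theory.
Import numFieldNormedType.Exports.

Local Open Scope classical_set_scope.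
Local Open Scope ring_scope.
Local Open Scope ereal_scope.

Set Implicit Arguments.
Unset Strict Implicit.
Unset Printing Implicit Defensive.

Local Close Scope ereal_scope.

(** Write F(g; S, Q) = int g dQ - int e^g dS + 1 for a bounded function g, a
    finite measure S and a probability Q.  Two facts carry the proof.

    The first is the variational formula H(Q | S) = sup_g F(g; S, Q).  That F is
    a lower bound is weak duality: with Y = dQ/dS, integrate
      log X <= log Y + X/Y - 1
    under Q and use E_Q[X/Y] <= E_S[X] <= 1; this gives E_Q[log X] <= H(Q | S)
    ([Elog_le_relent]).  That F exhausts H follows by truncating log Y
    ([dv_witness]).  On a Polish space g may be taken continuous
    ([continuous_dv_witness]), since continuous functions are dense in L1 of a
    finite Borel measure.  Because F(g; ., .) is then continuous for the given
    topologies, H is a supremum of continuous functions, and attains its infimum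
    on compact sets ([compact_sup_attains_inf]).

    The second is a minimax theorem ([compact_minimax]): if F is concave in g
    and convex in x, continuous in x, and for each point x of a compact K some g
    has F(g, x) > c, then one single g satisfies F(g, x) >= c for all x in K.

    Effective null.  If S is below no P in PP, every P is separated from S by a
    nonnegative continuous f with E_S[f] > E_P[f] + 1; minimax makes f
    independent of P, and a multiple of f is an e-variable with E_S[f] > 1.  So
    Peff PP = sol PP.  Since H(Q | .) is antitone, passing from PP to its solid
    hull does not change the minimum.

    Setwise compact alternatives.  If c < H(Q | P) for all pairs, minimax
    applied to F on PP x QQ yields one continuous g with F(g; P, Q) >= c
    throughout; then e^g / sup_P E_P[e^g] is a bounded e-variable whose expected
    log is at least c under every Q ([Gb_ge_dv_bound]).  With weak duality
    this squeezes Gb, G and the minimal relative entropy together.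

    Joint projections.  For a joint projection (S, Q0) with density version X0,
    the chain inf_Q H(Q | S) <= inf_Q E_Q[log X0] <= G <= inf_Q min_P H(Q | P)
    <= inf_Q H(Q | S) is a circle ([GROW_duality]).  For uniqueness, the
    Pythagorean inequality makes minimizing sequences converge to Q0 strongly
    enough that H(Q0 | S) <= inf_Q H(Q | S) ([GIPr_relent_le]).  If Q0 is one of
    the alternatives, any GROW e-variable X is thus log-optimal for Q0, so
    equality holds in log w <= w - 1 for w = X/Y, and X = Y almost surely
    ([log_optimal_unique]). *)

(** * Minimax on compact sets *)

(** The ratio (c - f) / (g - c) over points where f < c never exceeds the ratio
    (f - c) / (c - g) over points where g < c: otherwise some mixture of two such
    points would have both values below c.  The supremum u of the first ratios
    therefore separates the two families, and f + u g >= c (1 + u) on K. *)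
Lemma two_function_alternative (R : realType) (X : Type) (K : set X)
    (f g : X -> R) (c : R) :
  (forall x y, K x -> K y -> forall t, 0 <= t <= 1 -> exists2 z, K z &
     f z <= t * f x + (1 - t) * f y /\ g z <= t * g x + (1 - t) * g y) ->
  (forall x, K x -> c <= f x \/ c <= g x) ->
  exists2 t, 0 <= t <= 1 &
    forall x, K x -> c <= t * f x + (1 - t) * g x.
Proof.
move=> conv alt.
have [gc|/existsNP[b /not_implyP[Kb /negP]]] :=
  pselect (forall x, K x -> c <= g x).
  by exists 0 => [|x Kx]; rewrite ?lexx ?ler01// mul0r add0r subr0 mul1r gc.
rewrite -ltNge => gb.
pose S := [set s | exists2 a, K a /\ f a < c & s = (c - f a) / (g a - c)].
(* otherwise the mixture z below has both f z < c and g z < c *)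
have key a b' : K a -> f a < c -> K b' -> g b' < c ->
    (c - f a) * (c - g b') <= (g a - c) * (f b' - c).
  move=> Ka fa Kb' gb'; rewrite leNgt; apply/negP => lt.
  have ga : c <= g a by case: (alt _ Ka) => //; rewrite leNgt fa.
  have fb : c <= f b' by case: (alt _ Kb') => //; rewrite [c <= g _]leNgt gb'.
  pose p := c - f a; pose q := g a - c; pose r := f b' - c; pose w := c - g b'.
  have p0 : 0 < p by rewrite subr_gt0.
  have q0 : 0 <= q by rewrite subr_ge0.
  have r0 : 0 <= r by rewrite subr_ge0.
  have w0 : 0 < w by rewrite subr_gt0.
  have qrpw : q * r < p * w by [].
  (* the mixture at which the affine interpolations of f and g agree: both
     equal c - (p w - q r) / (p + q + r + w) *)
  pose t := (r + w) / (p + q + r + w).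
  have D0 : 0 < p + q + r + w by lra.
  have tD : t * (p + q + r + w) = r + w by rewrite /t divfK ?gt_eqF.
  have t01 : 0 <= t <= 1.
    by rewrite /t divr_ge0 ?ler_pdivrMr//=; lra.
  have [z Kz [fz gz]] := conv _ _ Ka Kb' _ t01.
  have eF : (t * f a + (1 - t) * f b') * (p + q + r + w) =
            c * (p + q + r + w) + (q * r - p * w).
    rewrite mulrDl mulrAC tD.
    have -> : (1 - t) * f b' * (p + q + r + w) = f b' * (p + q).
      by rewrite mulrAC mulrBl tD; ring.
    rewrite /p /q /r /w; ring.
  have eG : (t * g a + (1 - t) * g b') * (p + q + r + w) =
            c * (p + q + r + w) + (q * r - p * w).
    rewrite mulrDl mulrAC tD.
    have -> : (1 - t) * g b' * (p + q + r + w) = g b' * (p + q).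
      by rewrite mulrAC mulrBl tD; ring.
    rewrite /p /q /r /w; ring.
  have fzc : f z < c.
    apply: (le_lt_trans fz); rewrite -(ltr_pM2r D0) eF; lra.
  have gzc : g z < c.
    apply: (le_lt_trans gz); rewrite -(ltr_pM2r D0) eG; lra.
  by case: (alt _ Kz); rewrite leNgt ?fzc ?gzc.
have ubS b' : K b' -> g b' < c -> ubound S ((f b' - c) / (c - g b')).
  move=> Kb' gb' _ [a [Ka fa] ->].
  have := key _ _ Ka fa Kb' gb' => kab.
  have w0 : 0 < c - g b' by rewrite subr_gt0.
  have ga : c <= g a by case: (alt _ Ka) => //; rewrite leNgt fa.
  have q0 : 0 < g a - c.
    rewrite lt_neqAle subr_ge0 ga andbT eq_sym; apply/eqP => q0.
    move: kab; rewrite q0 mul0r leNgt mulr_gt0//; lra.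
  by rewrite ler_pdivlMr// mulrAC ler_pdivrMr// [leRHS]mulrC.
have [S0|SN0] := eqVneq S set0.
  exists 1 => [|x Kx]; first by rewrite ler01 lexx.
  rewrite mul1r subrr mul0r addr0 leNgt; apply/negP => fx.
  by have : S ((c - f x) / (g x - c)) by [exists x]; rewrite S0.
have supS : has_sup S.
  by split; [exact/set0P|exists ((f b - c) / (c - g b)); exact: ubS].
pose u := sup S.
have u0 : 0 <= u.
  have [s Ss] := supS.1; apply: le_trans (ub_le_sup supS.2 Ss).
  case: Ss => a [Ka fa] ->.
  apply: divr_ge0; rewrite subr_ge0; first exact: ltW.
  by case: (alt _ Ka) => //; rewrite leNgt fa.
have D0 : 0 < 1 + u by lra.
exists (1 + u)^-1.
  by rewrite invr_ge0 ltW//= invf_le1//; lra.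
move=> x Kx.
have -> : (1 + u)^-1 * f x + (1 - (1 + u)^-1) * g x = (f x + u * g x) / (1 + u).
  by field; rewrite gt_eqF.
rewrite ler_pdivlMr//.
have [fx|fx] := ltP (f x) c.
  have gx : c <= g x by case: (alt _ Kx) => //; rewrite leNgt fx.
  have : (c - f x) / (g x - c) <= u by apply: ub_le_sup; [exact: supS.2|exists x].
  have q0 : 0 < g x - c.
    rewrite lt_neqAle subr_ge0 gx andbT eq_sym; apply/eqP => q0.
    have := key _ _ Kx fx Kb gb; rewrite q0 mul0r leNgt mulr_gt0//; lra.
  rewrite ler_pdivrMr// => H; lra.
have [gx|gx] := ltP (g x) c; last first.
  by have := ler_wpM2l u0 gx; lra.
have : u <= (f x - c) / (c - g x) by apply: ge_sup; [exact: supS.1|exact: ubS].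
rewrite ler_pdivlMr ?subr_gt0// => H; lra.
Qed.

(** Induction on the list: on the part of K where the first function is below c,
    which is again stable under mixtures, the others already combine into one
    function that is at least c; the two-function case then merges it with the
    first. *)
Lemma finite_minimax (R : realType) (X : Type) (G : eqType) (C : set G)
    (F : G -> X -> R) (c : R) (gs : seq G) (K : set X) :
  (forall x y, K x -> K y -> forall t, 0 <= t <= 1 -> exists2 z, K z &
     forall g, C g -> F g z <= t * F g x + (1 - t) * F g y) ->
  (forall g h, C g -> C h -> forall t, 0 <= t <= 1 -> exists2 k, C k &
     forall x, t * F g x + (1 - t) * F h x <= F k x) ->
  C !=set0 -> (forall g, g \in gs -> C g) ->
  (forall x, K x -> exists2 g, g \in gs & c <= F g x) ->
  exists2 g, C g & forall x, K x -> c <= F g x.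
Proof.
move=> + concG [g1 Cg1]; elim: gs K => [|g0 gs IH] K convK Cgs Kgs.
  by exists g1 => // x /Kgs[].
pose K' := K `&` [set x | F g0 x < c].
have Cg0 : C g0 by apply: Cgs; rewrite mem_head.
have [g' Cg' g'P] : exists2 g, C g & forall x, K' x -> c <= F g x.
  apply: IH => [x y [Kx x0] [Ky y0] t /[dup] t01 /andP[t0 t1]||].
  - have [z Kz zP] := convK _ _ Kx Ky _ t01.
    exists z => //; split=> //=; apply: le_lt_trans (zP _ Cg0) _.
    rewrite /= in x0 y0; have [->|tN0] := eqVneq t 0; first lra.
    have t0' : 0 < t by rewrite lt_neqAle eq_sym tN0.
    have := ltr_pM2l t0' (F g0 x) c; rewrite x0 => ?.
    have : (1 - t) * F g0 y <= (1 - t) * c.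
      by apply: ler_wpM2l; [rewrite subr_ge0|exact: ltW].
    lra.
  - by move=> g gg; apply: Cgs; rewrite inE gg orbT.
  - move=> x [Kx x0]; have [g] := Kgs _ Kx; rewrite inE => /predU1P[->|]; last by exists g.
    by rewrite leNgt (x0 : F g0 x < c).
have [t t01 tP] : exists2 t, 0 <= t <= 1 &
    forall x, K x -> c <= t * F g' x + (1 - t) * F g0 x.
  apply: two_function_alternative => [x y Kx Ky t t01|x Kx].
    by have [z Kz zP] := convK _ _ Kx Ky _ t01; exists z => //; split; exact: zP.
  by have [g0x|g0x] := ltP (F g0 x) c; [left; exact: g'P|right].
have [k Ck kP] := concG _ _ Cg' Cg0 _ t01.
by exists k => // x Kx; exact: le_trans (tP _ Kx) (kP x).
Qed.

(** The extraction of finite subcovers for spaces that need not be pointed,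
    obtained by letting finite lists grow along their inclusion filter. *)
Lemma compact_finite_subcover (X : topologicalType) (I : eqType) (D : set I)
    (f : I -> set X) (K : set X) :
  compact K -> (forall i, D i -> open (f i)) -> K `<=` \bigcup_(i in D) f i ->
  exists2 s : seq I, (forall i, i \in s -> D i) &
    (forall x, K x -> exists2 i, i \in s & f i x).
Proof.
move=> /compact_near_coveringP cK fop Kf.
pose F := filter_from [set s : seq I | forall i, i \in s -> D i]
  (fun s => [set t : seq I | (forall i, i \in t -> D i) /\ {subset s <= t}]).
have FF : Filter F.
  apply: filter_from_filter; first by exists [::].
  move=> s t sD tD; exists (s ++ t) => [i|r [rD str]].
    by rewrite mem_cat => /orP[/sD|/tD].
  by split; split=> // i ii; apply: str; rewrite mem_cat ii ?orbT.
have /(cK _ F (fun s x => exists2 i, i \in s & f i x) FF)[s sD /(_ s) sP] :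
    forall x, K x -> \forall x' \near x & s \near F, exists2 i, i \in s & f i x'.
  move=> x /Kf[i Di fix_].
  exists (f i, [set t : seq I | i \in t]) => /=; last by move=> [y t] [/= ? ?]; exists i.
  split; first by apply: open_nbhs_nbhs; split=> //; exact: fop.
  exists [:: i] => [j|t [_]]; first by rewrite inE => /eqP ->.
  by apply; rewrite mem_head.
by exists s => //; apply: sP; split.
Qed.

Lemma compact_minimax (R : realType) (X : topologicalType) (G : eqType)
    (C : set G) (F : G -> X -> R) (c : R) (K : set X) :
  compact K -> (forall g, C g -> continuous (F g)) ->
  (forall x y, K x -> K y -> forall t, 0 <= t <= 1 -> exists2 z, K z &
     forall g, C g -> F g z <= t * F g x + (1 - t) * F g y) ->
  (forall g h, C g -> C h -> forall t, 0 <= t <= 1 -> exists2 k, C k &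
     forall x, t * F g x + (1 - t) * F h x <= F k x) ->
  C !=set0 -> (forall x, K x -> exists2 g, C g & c < F g x) ->
  exists2 g, C g & forall x, K x -> c <= F g x.
Proof.
move=> cK cF convK concG C0 KC.
have [||D DC KD] :=
  @compact_finite_subcover _ _ C (fun g => [set x | c < F g x]) K cK.
- move=> g Cg; apply: (@open_comp _ _ (F g) [set y | c < y]).
    by move=> x _; exact: cF.
  exact: open_gt.
- by move=> x /KC[g Cg ?]; exists g.
apply: (@finite_minimax _ _ _ C F c D K) => // x /KD[g gD /ltW cg].
by exists g.
Qed.

Lemma real_between (R : realType) (a b : \bar R) : (a < b)%E ->
  exists2 c : R, (a < c%:E)%E & (c%:E < b)%E.
Proof.
case: a b => [a| |] [b| |]//.
- by rewrite lte_fin => ab; exists ((a + b) / 2); rewrite lte_fin; lra.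
- by move=> _; exists (a + 1); rewrite ?ltry// lte_fin; lra.
- by move=> _; exists (b - 1); rewrite ?ltNyr// lte_fin; lra.
- by move=> _; exists 0; rewrite ?ltNyr ?ltry.
Qed.

(** If m = inf H is not attained, each point x carries some F g > r > m near x;
    a finite subcover leaves finitely many such r, and their least one is a lower
    bound of H that exceeds m. *)
Lemma compact_sup_attains_inf (R : realType) (X : topologicalType)
    (G : eqType) (C : set G) (F : G -> X -> R) (H : X -> \bar R) (K : set X) :
  compact K -> K !=set0 -> (forall g, C g -> continuous (F g)) ->
  (forall g x, C g -> K x -> ((F g x)%:E <= H x)%E) ->
  (forall x c, K x -> (c%:E < H x)%E -> exists2 g, C g & c < F g x) ->
  exists2 x, K x & H x = ereal_inf (H @` K).
Proof.
move=> cK [x0 Kx0] cF FH HF; apply: contrapT => noinf.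
set m := ereal_inf _ in noinf.
have mlt x : K x -> (m < H x)%E.
  move=> Kx; rewrite lt_neqAle ereal_inf_lbound ?andbT; last by exists x.
  by apply/eqP => mx; apply: noinf; exists x.
have dense x Kx := real_between (mlt x Kx).
have [||D DC KD] :=
  @compact_finite_subcover _ _ [set gc : G * R | C gc.1 /\ (m < gc.2%:E)%E]
    (fun gc => [set x | gc.2 < F gc.1 x]) K cK.
- move=> [g c] [Cg _]; apply: (@open_comp _ _ (F g) [set y | c < y]).
    by move=> x _; exact: cF.
  exact: open_gt.
- move=> x Kx; have [c mc cH] := dense _ Kx; have [g Cg gc] := HF _ _ Kx cH.
  by exists (g, c).
have [c1 mc1 c1D] : exists2 c1 : R, (m < c1%:E)%E &
    forall gc, gc \in D -> c1 <= gc.2.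
  have : forall gc, gc \in D -> (m < gc.2%:E)%E.
    by move=> gc /DC[].
  elim: D {DC KD} => [_|gc s IH sP].
    by have [c mc _] := dense _ Kx0; exists c.
  have [|c mc cP] := IH; first by move=> gc' gs; apply: sP; rewrite inE gs orbT.
  exists (Num.min c gc.2).
    by rewrite /Num.min; case: ifP => // _; apply: sP; rewrite mem_head.
  move=> gc'; rewrite inE => /predU1P[->|/cP]; rewrite ge_min ?lexx ?orbT//.
  by move=> ->.
suff : (c1%:E <= m)%E by rewrite leNgt mc1.
apply: le_ereal_inf_tmp => _ [x Kx <-].
have [gc gcD /= gcx] := KD _ Kx.
have [Cg _] := DC _ gcD.
apply: le_trans (FH _ _ Cg Kx); rewrite lee_fin (le_trans (c1D _ gcD))//.
exact: ltW.
Qed.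

(** * Bounded measurable functions *)

Section bounded_measurable.
Context {d : measure_display} {T : measurableType d} {R : realType}.
Implicit Types (f g h : T -> R) (mu : {finite_measure set T -> \bar R}).

Definition bounded_measurable f :=
  measurable_fun setT f /\ exists M : R, forall x, `|f x| <= M.

Lemma bounded_measurable_integrable mu f :
  bounded_measurable f -> mu.-integrable setT (EFin \o f).
Proof.
move=> [mf [M fM]]; apply: measurable_bounded_integrable => //.
  by rewrite ltey_eq fin_num_measure.
exists M; split; first exact: num_real.
by move=> x Mx y _; exact: le_trans (fM y) (ltW Mx).
Qed.

Lemma bounded_measurable_cst (c : R) : bounded_measurable (fun=> c : R).
Proof. by split=> //; exists `|c|. Qed.

Lemma bounded_measurableD f g : bounded_measurable f -> bounded_measurable g ->
  bounded_measurable (fun x => f x + g x).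
Proof.
move=> [mf [M fM]] [mg [N gN]]; split; first exact: measurable_funD.
by exists (M + N) => x; rewrite (le_trans (ler_normD _ _))// lerD.
Qed.

Lemma bounded_measurableZ (a : R) f : bounded_measurable f ->
  bounded_measurable (fun x => a * f x).
Proof.
move=> [mf [M fM]]; split; first exact: measurable_funM.
by exists (`|a| * M) => x; rewrite normrM ler_wpM2l.
Qed.

Lemma bounded_measurableB f g : bounded_measurable f -> bounded_measurable g ->
  bounded_measurable (fun x => f x - g x).
Proof.
move=> [mf [M fM]] [mg [N gN]]; split; first exact: measurable_funB.
by exists (M + N) => x; rewrite (le_trans (ler_normB _ _))// lerD.
Qed.

Lemma bounded_measurable_norm f : bounded_measurable f ->
  bounded_measurable (fun x => `|f x|).
Proof.
move=> [mf [M fM]]; split; first exact: measurableT_comp.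
by exists M => x; rewrite normr_id.
Qed.

Lemma bounded_measurable_expR f : bounded_measurable f ->
  bounded_measurable (fun x => expR (f x)).
Proof.
move=> [mf [M fM]]; split; first exact: measurableT_comp.
exists (expR M) => x; rewrite ger0_norm ?expR_ge0// ler_expR.
exact: le_trans (ler_norm _) (fM x).
Qed.

Lemma bounded_measurable_indic (A : set T) : measurable A ->
  bounded_measurable (\1_A : T -> R).
Proof.
move=> mA; split; first exact: measurable_indic.
by exists 1 => x; rewrite indicE; case: (x \in A); rewrite ?normr1 ?normr0.
Qed.

Lemma bounded_Rintegral_le mu f g : bounded_measurable f -> bounded_measurable g ->
  (forall x, f x <= g x) -> \int[mu]_x f x <= \int[mu]_x g x.
Proof.
by move=> bf bg fg; apply: le_Rintegral => //; exact: bounded_measurable_integrable.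
Qed.

Lemma bounded_RintegralD mu f g : bounded_measurable f -> bounded_measurable g ->
  \int[mu]_x (f x + g x) = \int[mu]_x f x + \int[mu]_x g x.
Proof.
by move=> bf bg; apply: RintegralD => //; exact: bounded_measurable_integrable.
Qed.

Lemma bounded_RintegralB mu f g : bounded_measurable f -> bounded_measurable g ->
  \int[mu]_x (f x - g x) = \int[mu]_x f x - \int[mu]_x g x.
Proof.
by move=> bf bg; apply: RintegralB => //; exact: bounded_measurable_integrable.
Qed.

Lemma bounded_RintegralZ mu (a : R) f : bounded_measurable f ->
  \int[mu]_x (a * f x) = a * \int[mu]_x f x.
Proof.
by move=> bf; apply: RintegralZl => //; exact: bounded_measurable_integrable.
Qed.

Lemma EFin_bounded_Rintegral mu f : bounded_measurable f ->
  (\int[mu]_x f x)%:E = (\int[mu]_x (f x)%:E)%E.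
Proof.
move=> bf; rewrite fineK//; apply: integrable_fin_num => //.
exact: bounded_measurable_integrable.
Qed.

Lemma bounded_Rintegral_dist mu f g : bounded_measurable f -> bounded_measurable g ->
  `|\int[mu]_x f x - \int[mu]_x g x| <= \int[mu]_x `|f x - g x|.
Proof.
move=> bf bg; rewrite -bounded_RintegralB//; apply: le_normr_Rintegral => //.
exact/bounded_measurable_integrable/bounded_measurableB.
Qed.

Lemma bounded_Rintegral_triangle mu f g h : bounded_measurable f ->
  bounded_measurable g -> bounded_measurable h ->
  \int[mu]_x `|f x - h x| <= \int[mu]_x `|f x - g x| + \int[mu]_x `|g x - h x|.
Proof.
move=> bf bg bh.
have nB u v : bounded_measurable u -> bounded_measurable v ->
    bounded_measurable (fun x => `|u x - v x|).
  by move=> bu bv; exact/bounded_measurable_norm/bounded_measurableB.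
rewrite -bounded_RintegralD; [|exact: nB..].
apply: bounded_Rintegral_le => [|| x].
- exact: nB.
- by apply: bounded_measurableD; exact: nB.
- by rewrite -[_ - h x](subrKA (g x)) ler_normD.
Qed.

Lemma bounded_eventually_eq_L1 mu (f_ : nat -> T -> R) f (M : R) :
  (forall n, measurable_fun setT (f_ n)) -> measurable_fun setT f ->
  (forall n x, `|f_ n x| <= M) -> (forall x, \forall n \near \oo, f_ n x = f x) ->
  forall e, 0 < e -> exists n, \int[mu]_x `|f x - f_ n x| <= e.
Proof.
move=> mf_ mf fM ff e e0.
have fMx x : `|f x| <= M by have [N _ /(_ N (leqnn _)) /= <-] := ff x.
have bf : bounded_measurable f by split=> //; exists M.
have bf_ n : bounded_measurable (f_ n) by split=> //; exists M.
have bd n : bounded_measurable (fun x => `|f x - f_ n x|).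
  exact/bounded_measurable_norm/bounded_measurableB.
have [|||||_ _ cv] := @dominated_convergence _ _ _ mu setT measurableT
    (fun n x => (`|f x - f_ n x|)%:E) (cst 0%E) (fun=> (M + M)%:E).
- by move=> n; apply/measurable_EFinP; case: (bd n).
- exact: measurable_cst.
- apply: aeW => x _; apply: cvg_near_cst; move: (ff x); apply: filterS => n ->.
  by rewrite subrr normr0.
- exact/bounded_measurable_integrable/bounded_measurable_cst.
- apply: aeW => x n _; rewrite gee0_abs ?lee_fin//.
  by rewrite (le_trans (ler_normB _ _))// lerD.
move: cv; rewrite integral_cst// mul0e => /fine_cvgP[_ /cvgrPdist_le /(_ _ e0)].
move=> [N _ /(_ N (leqnn _))] /=; rewrite sub0r normrN => H; exists N.
exact: le_trans (ler_norm _) H.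
Qed.

End bounded_measurable.

(** * Continuous approximation on Polish spaces *)

Lemma norm_le_max_itv (R : realDomainType) (a b y : R) :
  a <= y <= b -> `|y| <= Num.max `|a| `|b|.
Proof.
move=> /andP[ay yb]; rewrite ler_norml lerNl !le_max.
rewrite (le_trans yb (ler_norm b)) orbT andbT.
by rewrite -[X in - y <= X]normrN (le_trans _ (ler_norm (- a))) ?lerN2.
Qed.

Section continuous_approximation.
Context {R : realType} {Omega : ptopologicalType}.
Local Notation T := (borelType Omega).
Implicit Types (f g h : T -> R) (mu : {finite_measure set T -> \bar R}).

Definition bounded_continuous f :=
  continuous (f : Omega -> R) /\ exists M : R, forall x, `|f x| <= M.

Lemma continuous_borel_measurable f :
  continuous (f : Omega -> R) -> measurable_fun setT f.
Proof.
move=> cf; apply: (measurability _ (RGenOInfty.measurableE R)) => _ [_ [x ->] <-].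
rewrite setTI; apply: sub_sigma_algebra.
by move/continuousP : cf; apply; rewrite set_itvE; exact: open_gt.
Qed.

Lemma bounded_continuous_measurable f :
  bounded_continuous f -> bounded_measurable f.
Proof. by move=> [cf fM]; split=> //; exact: continuous_borel_measurable. Qed.

Lemma bounded_continuous_cst (c : R) : bounded_continuous (fun=> c : R).
Proof. by split; [move=> x; exact: cvg_cst|exists `|c|]. Qed.

Lemma bounded_continuousD f g : bounded_continuous f -> bounded_continuous g ->
  bounded_continuous (fun x => f x + g x).
Proof.
move=> [cf [M fM]] [cg [N gN]].
split; first by move=> x; apply: cvgD; [exact: cf|exact: cg].
by exists (M + N) => x; rewrite (le_trans (ler_normD _ _))// lerD.
Qed.

Lemma bounded_continuousZ (a : R) f : bounded_continuous f ->
  bounded_continuous (fun x => a * f x).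
Proof.
move=> [cf [M fM]]; split; first by move=> x; apply: cvgMr; exact: cf.
by exists (`|a| * M) => x; rewrite normrM ler_wpM2l.
Qed.

Definition L1_approximable mu h := bounded_measurable h /\
  forall e, 0 < e -> exists2 g, bounded_continuous g &
    \int[mu]_x `|h x - g x| <= e.

Lemma L1_approximable_cst mu (c : R) : L1_approximable mu (fun=> c).
Proof.
split=> [|e e0]; first exact: bounded_measurable_cst.
exists (fun=> c); first exact: bounded_continuous_cst.
by under eq_Rintegral do rewrite subrr normr0; rewrite Rintegral_cst// mul0r ltW.
Qed.

Lemma L1_approximableD mu f g : L1_approximable mu f -> L1_approximable mu g ->
  L1_approximable mu (fun x => f x + g x).
Proof.
move=> [bf af] [bg ag]; split=> [|e e0]; first exact: bounded_measurableD.
have e20 : 0 < e / 2 by rewrite divr_gt0.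
have [f' cf' ff'] := af _ e20; have [g' cg' gg'] := ag _ e20.
exists (fun x => f' x + g' x); first exact: bounded_continuousD.
have b u v : bounded_measurable u -> bounded_continuous v ->
    bounded_measurable (fun x => `|u x - v x|).
  move=> bu bv; apply/bounded_measurable_norm/bounded_measurableB => //.
  exact: bounded_continuous_measurable.
rewrite [leRHS]splitr; apply: le_trans (lerD ff' gg').
rewrite -bounded_RintegralD; [|exact: b..].
apply: bounded_Rintegral_le => [||x].
- by apply: b; [exact: bounded_measurableD|exact: bounded_continuousD].
- by apply: bounded_measurableD; exact: b.
- by rewrite opprD addrACA ler_normD.
Qed.

Lemma L1_approximableZ mu (a : R) f : L1_approximable mu f ->
  L1_approximable mu (fun x => a * f x).
Proof.
move=> [bf af]; split=> [|e e0]; first exact: bounded_measurableZ.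
have a0 : 0 < `|a| + 1 by rewrite ltr_wpDl.
have [f' cf' ff'] := af _ (divr_gt0 e0 a0).
exists (fun x => a * f' x); first exact: bounded_continuousZ.
have b : bounded_measurable (fun x => `|f x - f' x|).
  apply/bounded_measurable_norm/bounded_measurableB => //.
  exact: bounded_continuous_measurable.
under eq_Rintegral do rewrite -mulrBr normrM.
rewrite bounded_RintegralZ//; move: ff'; rewrite ler_pdivlMr// => ff'.
apply: le_trans ff'; rewrite mulrC ler_wpM2l//; last by rewrite lerDl.
by apply: Rintegral_ge0.
Qed.

Lemma L1_approximable_closed mu h : bounded_measurable h ->
  (forall e, 0 < e -> exists2 g, L1_approximable mu g &
     \int[mu]_x `|h x - g x| <= e) -> L1_approximable mu h.
Proof.
move=> bh ah; split=> // e e0; have e20 : 0 < e / 2 by rewrite divr_gt0.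
have [g [bg ag] hg] := ah _ e20; have [k ck gk] := ag _ e20.
exists k => //; rewrite [leRHS]splitr.
apply: le_trans (bounded_Rintegral_triangle mu bh bg _) (lerD hg gk).
exact: bounded_continuous_measurable.
Qed.

Lemma L1_approximable_eventually_eq mu (h_ : nat -> T -> R) h (M : R) :
  (forall n, L1_approximable mu (h_ n)) -> measurable_fun setT h ->
  (forall n x, `|h_ n x| <= M) -> (forall x, \forall n \near \oo, h_ n x = h x) ->
  L1_approximable mu h.
Proof.
move=> ah mh hM hh; apply: L1_approximable_closed.
  by split=> //; exists M => x; have [N _ /(_ N (leqnn _)) /= <-] := hh x.
move=> e e0; have mh_ n : measurable_fun setT (h_ n) by case: (ah n) => -[].
have [n] := bounded_eventually_eq_L1 mu mh_ mh hM hh e0.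
by exists (h_ n).
Qed.

Lemma bounded_continuous_approximable mu f :
  bounded_continuous f -> L1_approximable mu f.
Proof.
move=> cf; split=> [|e e0]; first exact: bounded_continuous_measurable.
exists f => //; under eq_Rintegral do rewrite subrr normr0.
by rewrite Rintegral_cst// mul0r ltW.
Qed.

(** The points whose 1/n-ball stays in U are uniformly separated from the
    complement of U, so a Urysohn function is 1 on the former and 0 on the
    latter; these functions are eventually equal to the indicator of U at each
    point. *)
Lemma L1_approximable_open mu (U : set Omega) : polish R Omega ->
  open U -> L1_approximable mu (\1_U : T -> R).
Proof.
move=> [_ [M [f [g [fK gK cf cg _]]]]] oU.
pose V := g @^-1` U.
have oV : open V by move/continuousP : cg; apply.
pose C n := [set y | ball y (n.+1%:R^-1 : R) `<=` V].
have sep n : uniform_separator (~` V) (C n).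
  apply: uniform_separatorW.
  exists [set xy | ball xy.1 (n.+1%:R^-1 : R) xy.2].
    exact: (entourage_ball M (PosNum (_ : 0 < n.+1%:R^-1 :> R))).
  rewrite -subset0 => -[a b] [[/= Va Cb]] /ball_sym ab.
  by apply: Va; exact: Cb.
pose h n x := Urysohn (R := R) (~` V) (C n) (f x).
have h01 n x : 0 <= h n x <= 1.
  have := @Urysohn_range M R (~` V) (C n) (h n x); rewrite /= in_itv/=; apply.
  by exists (f x).
have ch n : continuous (h n : Omega -> R).
  move=> x; apply: (@continuous_comp Omega M R f _ x); first exact: cf.
  exact: Urysohn_continuous.
apply: (@L1_approximable_eventually_eq mu h _ 1).
- move=> n; apply: bounded_continuous_approximable; split; first exact: ch.
  by exists 1 => x; have /andP[h0 h1] := h01 n x; rewrite ger0_norm.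
- apply: measurable_indic; exact: sub_sigma_algebra.
- by move=> n x; have /andP[h0 h1] := h01 n x; rewrite ger0_norm.
move=> x; have [Ux|nUx] := pselect (U x); last first.
  near=> n; rewrite indicE memNset//.
  apply: (@Urysohn_sub0 M R (~` V) (C n) (sep n)); exists (f x) => //=.
  by rewrite /V /= fK.
have : nbhs (f x) V by apply: open_nbhs_nbhs; split=> //; rewrite /V /= fK.
move=> /nbhs_ballP[e /= e0 eV].
near=> n; rewrite indicE mem_set//.
apply: (@Urysohn_sub1 M R (~` V) (C n) (sep n)); exists (f x) => //=.
rewrite /C /=; apply: subset_trans eV; apply: le_ball.
rewrite ltW//; near: n; exact: near_infty_natSinv_lt (PosNum e0).
Unshelve. all: by end_near. Qed.

(** By the pi-lambda theorem: open sets are stable under intersection, and sets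
    with approximable indicator form a lambda-system, because indicators of
    proper differences are differences and those of increasing unions are
    eventually constant at each point. *)
Lemma L1_approximable_indic mu (A : set T) : polish R Omega ->
  measurable A -> L1_approximable mu (\1_A : T -> R).
Proof.
move=> pO mA.
pose H := [set A : set T | measurable A /\ L1_approximable mu (\1_A : T -> R)].
suff : H A by case.
move: A mA; apply: (@lambda_system_subset _ _ _ setT H) => //.
- exact: openI.
- split=> //.
  + split=> //; rewrite (_ : \1_setT = fun=> 1); last first.
      by apply/funext => x; rewrite indicE in_setT.
    exact: L1_approximable_cst.
  + move=> A B BA [mA aA] [mB aB]; split; first exact: measurableD.
    rewrite (_ : \1_(A `\` B) = fun x => \1_A x + -1 * \1_B x).
      exact/L1_approximableD/L1_approximableZ.
    apply/funext => x; rewrite !indicE mulN1r.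
    have [xB|xB] := boolP (x \in B).
      rewrite [x \in A](_ : _ = true); last by apply/mem_set/BA/set_mem.
      by rewrite memNset ?subrr// => -[_]; apply; exact: set_mem.
    rewrite subr0; congr (_%:R); congr nat_of_bool.
    by rewrite in_setD xB andbT.
  + move=> F ndF HF; split; first by apply: bigcup_measurable => k _; case: (HF k).
    apply: (@L1_approximable_eventually_eq mu (fun n => \1_(F n)) _ 1).
    * by move=> n; case: (HF n).
    * by apply: measurable_indic; apply: bigcup_measurable => k _; case: (HF k).
    * by move=> n x; rewrite indicE; case: (_ \in _); rewrite ?normr1 ?normr0.
    move=> x; have [[N _ FNx]|nFx] := pselect ((\bigcup_i F i) x).
      exists N => // n /= Nn; rewrite !indicE !mem_set//; first by exists N.
      by have /subsetPset := ndF _ _ Nn; exact.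
    near=> n; rewrite !indicE !memNset// => Fnx.
    by apply: nFx; exists n.
- move=> U oU; split; first exact: sub_sigma_algebra.
  exact: L1_approximable_open.
Unshelve. all: by end_near. Qed.

(** The binary digits of h: the first one is the indicator of h >= 1/2, and
    removing it leaves (2 h - digit) / 2 with 2 h - digit again in [0, 1]. *)
Lemma uniform_indic_approximation mu h n : polish R Omega ->
  measurable_fun setT h -> (forall x, 0 <= h x <= 1) ->
  exists2 s, L1_approximable mu s & forall x, `|h x - s x| <= 2^-1 ^+ n.
Proof.
move=> pO; elim: n h => [|n IH] h mh h01.
  exists (fun=> 0); first exact: L1_approximable_cst.
  by move=> x; have /andP[h0 h1] := h01 x; rewrite subr0 ger0_norm.
pose A := [set x | 2^-1 <= h x].
have mA : measurable A.
  rewrite (_ : A = setT `&` h @^-1` `[2^-1, +oo[%classic); first exact: mh.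
  by apply/seteqP; split=> x /=; rewrite in_itv/= andbT//; case.
have [||s as_ sP] := IH (fun x => 2 * h x - \1_A x).
- by apply: measurable_funB; [exact: measurable_funM|exact: measurable_indic].
- move=> x; have /andP[h0 h1] := h01 x; rewrite indicE.
  have [xA|xA] := pselect (A x).
    rewrite mem_set//= mulr1n; move: xA; rewrite /A /= => xA.
    by apply/andP; split; lra.
  rewrite memNset//= mulr0n; move: xA; rewrite /A /= => /negP.
  by rewrite -ltNge => xA; apply/andP; split; lra.
exists (fun x => 2^-1 * \1_A x + 2^-1 * s x).
  apply: L1_approximableD; apply: L1_approximableZ => //.
  exact: L1_approximable_indic.
move=> x; rewrite exprS.
rewrite (_ : h x - _ = 2^-1 * (2 * h x - \1_A x - s x)); last by field.
by rewrite normrM ger0_norm// ler_wpM2l.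
Qed.

Lemma L1_approximable_bounded_measurable mu h : polish R Omega ->
  bounded_measurable h -> L1_approximable mu h.
Proof.
move=> pO [mh [M hM]].
have M0 : 0 <= M by rewrite (le_trans _ (hM point)).
pose K := 2 * M + 1; have K0 : 0 < K by rewrite /K; lra.
pose k x := K^-1 * (h x + M).
have mk : measurable_fun setT k.
  by apply: measurable_funM => //; exact: measurable_funD.
have k01 x : 0 <= k x <= 1.
  have := hM x; rewrite ler_norml => /andP[h1 h2].
  apply/andP; split.
    by apply: mulr_ge0; [rewrite invr_ge0 ltW|lra].
  by rewrite /k ler_pdivrMl// mulr1 /K; lra.
suff ak : L1_approximable mu k.
  rewrite (_ : h = fun x => K * k x + - M); last first.
    by apply/funext => x; rewrite /k mulVKf ?gt_eqF// addrK.
  by apply: L1_approximableD; [exact: L1_approximableZ|exact: L1_approximable_cst].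
apply: L1_approximable_closed.
  split=> //; exists 1 => x; have /andP[k0 k1] := k01 x.
  by rewrite ger0_norm.
move=> e e0; pose m := fine (mu setT).
have m0 : 0 <= m by exact: fine_ge0.
have e1 : 0 < e / (m + 1) by rewrite divr_gt0// ltr_wpDl.
have [n ne] : exists n, 2^-1 ^+ n <= e / (m + 1).
  have : (fun n => 2^-1 ^+ n : R) @ \oo --> (0 : R).
    by apply: cvg_expr; rewrite ger0_norm ?invf_lt1// ltr1n.
  move=> /cvgrPdist_le /(_ _ e1)[n _ /(_ n (leqnn _))] /=.
  by rewrite sub0r normrN => H; exists n; exact: le_trans (ler_norm _) H.
have [s as_ sP] := uniform_indic_approximation mu n pO mk k01.
exists s => //; have [bs _] := as_.
apply: (@le_trans _ _ (\int[mu]_x (e / (m + 1)))).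
  apply: bounded_Rintegral_le => [||x].
  - apply/bounded_measurable_norm/bounded_measurableB => //.
    by split=> //; exists 1 => x; have /andP[k0 k1] := k01 x; rewrite ger0_norm.
  - exact: bounded_measurable_cst.
  - exact: le_trans (sP x) ne.
rewrite Rintegral_cst// -/m -mulrA ger_pMr// ler_pdivrMl; last by rewrite ltr_wpDl.
by rewrite mulr1 lerDl.
Qed.

(** Clamping the approximating function to the range of h only brings it closer
    to h. *)
Lemma L1_continuous_approximation mu h (a b e : R) : polish R Omega ->
  measurable_fun setT h -> (forall x, a <= h x <= b) -> 0 < e ->
  exists g, [/\ bounded_continuous g, forall x, a <= g x <= b &
    \int[mu]_x `|h x - g x| <= e].
Proof.
move=> pO mh hab e0.
have bh : bounded_measurable h.
  by split=> //; exists (Num.max `|a| `|b|) => x; exact: norm_le_max_itv.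
have [_ /(_ _ e0)[g cg hg]] := L1_approximable_bounded_measurable mu pO bh.
have ab : a <= b by have /andP[h1 h2] := hab point; exact: le_trans h2.
pose k x := Num.max a (Num.min b (g x)).
have kab x : a <= k x <= b by rewrite /k le_max lexx ge_max ab ge_min lexx.
have ck : bounded_continuous k.
  split.
    move=> x; apply: (@continuous_max R Omega (fun=> a) (fun x => Num.min b (g x)) x).
      exact: cvg_cst.
    apply: (@continuous_min R Omega (fun=> b) g x); first exact: cvg_cst.
    by case: cg => + _; exact.
  by exists (Num.max `|a| `|b|) => x; exact: norm_le_max_itv.
exists k; split=> //; apply: le_trans hg.
apply: bounded_Rintegral_le => [||x].
- apply/bounded_measurable_norm/bounded_measurableB => //.
  exact: bounded_continuous_measurable.
- apply/bounded_measurable_norm/bounded_measurableB => //.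
  exact: bounded_continuous_measurable.
have /andP[h1 h2] := hab x.
have [ga|ga] := ltP (g x) a.
  rewrite /k (min_r (ltW (lt_le_trans ga ab))) (max_l (ltW ga)).
  by rewrite !ger0_norm; lra.
have [gb|gb] := ltP b (g x); last by rewrite /k (min_r gb) (max_r ga).
by rewrite /k (min_l (ltW gb)) (max_r ab) !ler0_norm; lra.
Qed.

End continuous_approximation.

(** * Relative entropy and weak duality *)

Section relative_entropy.
Context {d : measure_display} {T : measurableType d} {R : realType}.
Implicit Types (Q : probability T R) (S : {finite_measure set T -> \bar R}).
Implicit Types (X Y : T -> \bar R) (f g : T -> R).
Local Open Scope ereal_scope.

Lemma measurable_lne : measurable_fun setT (@lne R).
Proof.
apply: (measurability _ (ErealGenOInfty.measurableE R)) => _ [_ [x ->] <-].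
rewrite setTI (_ : _ @^-1` _ = `](expR x)%:E, +oo[%classic).
  exact: emeasurable_itv.
apply/seteqP; split => -[y| |] /=; rewrite !in_itv/= ?andbT ?ltry//.
  case: ifPn => //; rewrite -ltNge => y0.
  have yE : expR (ln y) = y by rewrite lnK.
  by rewrite !lte_fin -{2}yE ltr_expR.
rewrite lte_fin => xy; have y0 : (0 < y)%R by rewrite (lt_trans _ xy) ?expR_gt0.
by rewrite leNgt y0/= lte_fin -ltr_expR lnK.
Qed.

(** The version of dQ/dS that is nonnegative everywhere; the Radon-Nikodym
    derivative of a charge is so almost everywhere only. *)
Definition density Q S : T -> \bar R := Radon_Nikodym_SigmaFinite.f Q S.

Lemma density_ge0 Q S x : Q `<< S -> 0 <= density Q S x.
Proof. by move=> QS; exact: Radon_Nikodym_SigmaFinite.f_ge0. Qed.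

Lemma densityK Q S x : Q `<< S -> density Q S x = (fine (density Q S x))%:E.
Proof. by move=> QS; rewrite fineK// Radon_Nikodym_SigmaFinite.f_fin_num. Qed.

Lemma measurable_density Q S : Q `<< S -> measurable_fun setT (density Q S).
Proof.
by move=> QS; exact: measurable_int (Radon_Nikodym_SigmaFinite.f_integrable QS).
Qed.

Lemma relentE Q S : Q `<< S -> relent Q S = \int[Q]_x lne (density Q S x).
Proof.
move=> QS; rewrite /relent asboolT//; apply: ae_eq_integral => //.
- apply: measurableT_comp; first exact: measurable_lne.
  by apply: measurable_int; exact: Radon_Nikodym_integrable.
- by apply: measurableT_comp; [exact: measurable_lne|exact: measurable_density].
apply: ae_eq_comp; apply: (null_dominates_ae_eq measurableT QS).
by apply: ae_eq_sym; exact: ae_eq_Radon_Nikodym_SigmaFinite.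
Qed.

Lemma density_gt0 Q S : Q `<< S -> {ae Q, forall x, 0 < density Q S x}.
Proof.
move=> QS; have mY := measurable_density QS.
pose N := density Q S @^-1` [set 0].
have mN : measurable N by rewrite -[N]setTI; exact: mY.
exists N; split=> //.
  have := Radon_Nikodym_SigmaFinite.f_integral QS mN => ->.
  by apply: integral0_eq => x /=.
move=> x /= Y0; apply/eqP; apply: contra_notT Y0 => Y0.
by rewrite lt_neqAle eq_sym Y0 density_ge0.
Qed.

(** The inverse of the density, set to 1 where the density vanishes: a positive
    real function whose measurability comes from that of [ln] and [expR]. *)
Definition recip_density Q S x : R := expR (- ln (fine (density Q S x))).

Lemma measurable_recip_density Q S : Q `<< S ->
  measurable_fun setT (recip_density Q S).
Proof.
move=> QS; apply: measurableT_comp => //; apply: measurableT_comp => //.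
apply: measurableT_comp => //; apply: measurableT_comp => //.
exact: measurable_density.
Qed.

(** Changing variables, the left side is the integral of X over the set where
    the density is positive. *)
Lemma integral_ratio_le Q S X : Q `<< S -> measurable_fun setT X ->
  (forall x, 0 <= X x) ->
  \int[Q]_x (X x * (recip_density Q S x)%:E) <= \int[S]_x X x.
Proof.
move=> QS mX X0.
have W0 x : 0 <= X x * (recip_density Q S x)%:E.
  by rewrite mule_ge0// lee_fin expR_ge0.
have mW : measurable_fun setT (fun x => X x * (recip_density Q S x)%:E).
  apply: emeasurable_funM => //; apply/measurable_EFinP.
  exact: measurable_recip_density.
rewrite -(Radon_Nikodym_SigmaFinite.change_of_variables QS W0 measurableT mW).
apply: ge0_le_integral => //.
- by move=> x _; rewrite mule_ge0// density_ge0.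
- by apply: emeasurable_funM => //; exact: measurable_density.
move=> x _; rewrite -/(density Q S x) -muleA [X in _ * X]muleC densityK//.
have Y0 : (0 <= fine (density Q S x))%R by rewrite fine_ge0// density_ge0.
have [->|Y0'] := eqVneq (fine (density Q S x)) 0%R.
  by rewrite mul0e mule0.
rewrite /recip_density -EFinM expRN lnK ?mulfV ?mule1//.
by rewrite posrE lt_neqAle eq_sym Y0' Y0.
Qed.

(** A quantitative defect in [ln w <= w - 1]; it vanishes only at [w = 1], which
    is what turns the equality case of weak duality into uniqueness. *)
Definition log_slack (w : R) : R := (Num.sqrt w - 1) ^+ 2.

(** Apply [ln s <= s - 1] to the square root s of w. *)
Lemma ln_slack (w : R) : (0 < w)%R -> (ln w + log_slack w <= w - 1)%R.
Proof.
move=> w0; have s0 : (0 < Num.sqrt w)%R by rewrite sqrtr_gt0.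
have sw : (w = Num.sqrt w ^+ 2)%R by rewrite sqr_sqrtr// ltW.
have -> : (ln w = 2 * ln (Num.sqrt w))%R.
  by rewrite [in LHS]sw expr2 lnM// mulr2n mulrDl !mul1r.
have := @le_ln1Dx R (Num.sqrt w - 1).
rewrite addrCA subrr addr0 => H.
have : (ln (Num.sqrt w) <= Num.sqrt w - 1)%R by apply: H; lra.
rewrite /log_slack; move: sw; set s := Num.sqrt w; set l := ln s => -> ?.
rewrite !expr2; lra.
Qed.

Lemma measurable_log_slack (f : T -> \bar R) : measurable_fun setT f ->
  measurable_fun setT (fun x => (log_slack (fine (f x)))%:E).
Proof.
move=> mf; apply/measurable_EFinP; apply: measurable_funX.
apply: measurable_funB => //.
apply: (@measurableT_comp _ _ _ _ _ _ (@Num.sqrt R)).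
  by apply: continuous_measurable_fun; exact: sqrt_continuous.
exact: measurableT_comp.
Qed.

(** The inequality log X + slack <= log y + X/y - 1, with positive and negative
    parts distributed so that both sides are sums of nonnegative terms: in this
    form it also holds for X = 0 and X = +oo, and can be integrated without
    integrability assumptions. *)
Lemma log_slack_pointwise (X y : \bar R) (z : R) : 0 <= X -> 0 < y -> y \is a fin_num ->
  z = expR (- ln (fine y)) ->
  maxe (lne X) 0 + maxe (- lne y) 0 + 1 + (log_slack (fine (X * z%:E)))%:E <=
  maxe (lne y) 0 + maxe (- lne X) 0 + X * z%:E.
Proof.
move=> X0 y0 yfin zE; move: yfin y0 zE => /fineK <-; move: (fine y) => {}y.
rewrite lte_fin/= => y0 ->.
have z0 : (0 < expR (- ln y))%R by exact: expR_gt0.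
have R0 : 0 <= maxe (if (y <= 0)%R then -oo else (ln y)%:E) 0.
  by rewrite le_max lexx orbT.
case: X X0 => [x| |]//.
  rewrite lee_fin le_eqVlt => /predU1P[<-|x0].
    rewrite /= lexx /= (max_l (leey _)) ?leey// -?EFinM.
    by rewrite addey -?ltNye ?(lt_le_trans _ R0)// addye// leey.
  rewrite /= (lt_geF x0) (lt_geF y0) -?EFinN -!EFin_max -?EFinM -!EFinD.
  rewrite lee_fin/=.
  have w0 : (0 < x * expR (- ln y))%R by rewrite mulr_gt0.
  have := ln_slack w0; rewrite lnM ?posrE// expRK.
  set a := ln x; set b := ln y.
  have H (u : R) : (Num.max u 0 = u + Num.max (- u) 0)%R.
    have [u0|u0] := leP 0%R u.
      by rewrite max_r ?addr0// oppr_le0.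
    by rewrite max_l ?subrr// oppr_ge0 ltW.
  by rewrite (H a) (H b); lra.
move=> _ /=; rewrite mulyr gtr0_sg// mul1e [leRHS]addey ?leey//.
by rewrite -ltNye (@lt_le_trans _ _ 0)// adde_ge0// le_max lexx orbT.
Qed.

(** Finiteness of B is what excludes the indeterminate difference on the right;
    on the left +oo - +oo is -oo, in accordance with the convention for expected
    logarithms. *)
Lemma ereal_balance (A B C D I W : \bar R) : 0 <= A -> 0 <= B -> 0 <= C ->
  0 <= D -> 0 <= I -> 0 <= W -> W <= 1 -> B < +oo -> A + B + 1 + I <= C + D + W ->
  A - D + I <= C - B.
Proof.
case: A B C D I W => [a| |] [b| |] [c| |] [e| |] [i| |] [w| |]//=;
  rewrite ?lee_fin ?leey ?leNye//; lra.
Qed.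

Lemma integral_prob_cst1 Q : \int[Q]_x (cst 1%E) x = 1.
Proof. by rewrite integral_cst// mul1e; exact: probability_setT. Qed.

(** The negative part of log Y is at most 1/Y, and E_Q[1/Y] <= S(T). *)
Lemma integral_log_density_neg_lty Q S : Q `<< S ->
  \int[Q]_x (fun x => lne (density Q S x))^\- x < +oo.
Proof.
move=> QS; have mY := measurable_density QS.
have m1 : measurable_fun setT (fun x => (1 * (recip_density Q S x)%:E)%E).
  apply: emeasurable_funM => //; apply/measurable_EFinP.
  exact: measurable_recip_density.
apply: (@le_lt_trans _ _ (\int[Q]_x (1 * (recip_density Q S x)%:E))).
  apply: ae_ge0_le_integral => //.
  - by apply: measurable_funeneg; apply: measurableT_comp => //; exact: measurable_lne.
  - by move=> x _; rewrite mul1e lee_fin expR_ge0.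
  - move: (density_gt0 QS); apply: filterS => x Y0 _.
    rewrite mul1e funenegE /=; move: Y0; rewrite densityK//= lte_fin => y0.
    rewrite (lt_geF y0) -EFinN -EFin_max lee_fin ge_max expR_ge0 andbT.
    rewrite /recip_density; set u := (- ln _)%R.
    by have := expR_ge1Dx u; lra.
apply: (le_lt_trans (integral_ratio_le QS _ _)) => //.
by rewrite integral_cst// mul1e ltey_eq fin_num_measure.
Qed.

(** Weak duality with a remainder. *)
Lemma log_duality Q S X : Q `<< S -> measurable_fun setT X ->
  (forall x, 0 <= X x) -> \int[S]_x X x <= 1 ->
  Elog Q X + \int[Q]_x (log_slack (fine (X x * (recip_density Q S x)%:E)))%:E
    <= relent Q S.
Proof.
move=> QS mX X0 X1; rewrite relentE// /Elog integralE [leRHS]integralE.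
have mY := measurable_density QS.
have mlX : measurable_fun setT (fun x => lne (X x)).
  by apply: measurableT_comp => //; exact: measurable_lne.
have mlY : measurable_fun setT (fun x => lne (density Q S x)).
  by apply: measurableT_comp => //; exact: measurable_lne.
set W := fun x => X x * (recip_density Q S x)%:E.
have W0 x : 0 <= W x by rewrite mule_ge0// lee_fin expR_ge0.
have mW : measurable_fun setT W.
  apply: emeasurable_funM => //; apply/measurable_EFinP.
  exact: measurable_recip_density.
have mI : measurable_fun setT (fun x => (log_slack (fine (W x)))%:E).
  exact: measurable_log_slack.
have I0 x : 0 <= (log_slack (fine (W x)))%:E by rewrite lee_fin sqr_ge0.
apply: (@ereal_balance _ _ _ _ _ (\int[Q]_x W x)).
- exact: integral_ge0.
- exact: integral_ge0.
- exact: integral_ge0.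
- exact: integral_ge0.
- by apply: integral_ge0 => x _; exact: I0.
- by apply: integral_ge0 => x _; exact: W0.
- exact: le_trans (integral_ratio_le QS mX X0) X1.
- exact: integral_log_density_neg_lty.
rewrite -[X in _ + X + _ <= _](integral_prob_cst1 Q).
pose nng (f : T -> \bar R) := measurable_fun setT f /\ forall x, 0 <= f x.
have np (f : T -> \bar R) : measurable_fun setT f -> nng f^\+.
  by move=> mf; split=> //; exact: measurable_funepos.
have nn (f : T -> \bar R) : measurable_fun setT f -> nng f^\-.
  by move=> mf; split=> //; exact: measurable_funeneg.
have nD (f g : T -> \bar R) : nng f -> nng g -> nng (fun x => f x + g x).
  move=> [mf f0] [mg g0]; split; first exact: emeasurable_funD.
  by move=> x; rewrite adde_ge0.
have iD (f g : T -> \bar R) : nng f -> nng g ->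
    \int[Q]_x f x + \int[Q]_x g x = \int[Q]_x (f x + g x).
  by move=> [mf f0] [mg g0]; rewrite ge0_integralD.
have n1 : nng (cst 1) by split.
have nI : nng (fun x => (log_slack (fine (W x)))%:E) by split.
have nW : nng W by split.
have nL1 := nD _ _ (np _ mlX) (nn _ mlY); have nL2 := nD _ _ nL1 n1.
have nL3 := nD _ _ nL2 nI.
have nR1 := nD _ _ (np _ mlY) (nn _ mlX); have nR2 := nD _ _ nR1 nW.
rewrite (iD _ _ (np _ mlX) (nn _ mlY)) (iD _ _ nL1 n1) (iD _ _ nL2 nI).
rewrite (iD _ _ (np _ mlY) (nn _ mlX)) (iD _ _ nR1 nW).
case: nL3 nR2 => mL L0 [mR R0]; apply: ae_ge0_le_integral => //.
move: (density_gt0 QS); apply: filterS => x Y0 _.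
rewrite !funeposE !funenegE; apply: log_slack_pointwise => //.
by rewrite densityK.
Qed.

Lemma Elog_le_relent Q S X : measurable_fun setT X ->
  (forall x, 0 <= X x) -> \int[S]_x X x <= 1 -> Elog Q X <= relent Q S.
Proof.
move=> mX X0 X1; have [QS|nQS] := pselect (Q `<< S); last first.
  by rewrite /relent asboolF// leey.
apply: le_trans (log_duality QS mX X0 X1); rewrite leeDl//.
by apply: integral_ge0 => x _; rewrite lee_fin sqr_ge0.
Qed.

(** The unnormalized Donsker-Varadhan functional.  It is affine in the pair of
    measures, whereas the usual form with the logarithm of the exponential
    moment is only convex in S. *)
Definition dv_functional g S Q : R :=
  (\int[Q]_x g x - \int[S]_x expR (g x) + 1)%R.

Lemma relent_not_dominated Q S : ~ Q `<< S -> relent Q S = +oo.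
Proof. by move=> nQS; rewrite /relent asboolF. Qed.

Lemma bounded_measurable_scaled_exp g (k : R) : bounded_measurable g ->
  bounded_measurable (fun x => k * expR (g x))%R.
Proof. by move=> bg; exact/bounded_measurableZ/bounded_measurable_expR. Qed.

Lemma Elog_exp Q g (k : R) : bounded_measurable g -> (0 < k)%R ->
  Elog Q (fun x => (k * expR (g x))%:E) = (\int[Q]_x g x + ln k)%:E.
Proof.
move=> bg k0; rewrite /Elog.
under eq_integral.
  move=> x _; rewrite lne_EFin ?mulr_gt0 ?expR_gt0// lnM ?posrE ?expR_gt0//.
  rewrite expRK addrC; over.
rewrite -EFin_bounded_Rintegral; last first.
  by apply: bounded_measurableD => //; exact: bounded_measurable_cst.
rewrite bounded_RintegralD//; last exact: bounded_measurable_cst.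
by rewrite Rintegral_cst// [X in fine X](probability_setT Q) mulr1.
Qed.

(** Weak duality for the normalized exponential e^g / K, with ln K <= K - 1. *)
Lemma dv_functional_le_relent Q S g : bounded_measurable g ->
  (dv_functional g S Q)%:E <= relent Q S.
Proof.
move=> bg; have [QS|/relent_not_dominated ->] := pselect (Q `<< S); last exact: leey.
have be := bounded_measurable_expR bg.
set K := (\int[S]_x expR (g x))%R.
have S0 : (0 < fine (S setT))%R.
  rewrite lt_neqAle fine_ge0// andbT eq_sym; apply/eqP => S0.
  have ST : S setT = 0 by rewrite -[LHS]fineK ?fin_num_measure// S0.
  move/null_content_dominatesP : QS => /(_ setT measurableT ST)/eqP.
  by rewrite [X in X == _](probability_setT Q) onee_eq0.
have K0 : (0 < K)%R.
  case: bg => [mg [M gM]].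
  apply: (@lt_le_trans _ _ (\int[S]_x (expR (- M)))%R).
    by rewrite Rintegral_cst// mulr_gt0 ?expR_gt0.
  apply: bounded_Rintegral_le => //; first exact: bounded_measurable_cst.
  by move=> x; rewrite ler_expR; have := gM x; rewrite ler_norml => /andP[].
have : Elog Q (fun x => (K^-1 * expR (g x))%:E) <= relent Q S.
  apply: Elog_le_relent.
  - by apply/measurable_EFinP; case: (bounded_measurable_scaled_exp K^-1 bg).
  - by move=> x; rewrite lee_fin mulr_ge0 ?expR_ge0// invr_ge0 ltW.
  rewrite -EFin_bounded_Rintegral; last exact: bounded_measurable_scaled_exp.
  by rewrite bounded_RintegralZ// -/K mulVf ?gt_eqF.
apply: le_trans; rewrite Elog_exp ?invr_gt0// lee_fin /dv_functional -/K lnV//.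
have := @le_ln1Dx R (K - 1)%R; rewrite addrCA subrr addr0.
rewrite ltrBrDl subrr => /(_ K0); lra.
Qed.

End relative_entropy.

(** * The variational formula *)

Section variational_formula.
Context {d : measure_display} {T : measurableType d} {R : realType}.
Implicit Types (Q : probability T R) (S : {finite_measure set T -> \bar R}).
Local Open Scope ereal_scope.

(** A large multiple of the indicator of an S-null set charged by Q raises the
    integral under Q and leaves the exponential moment under S unchanged. *)
Lemma dv_witness_singular Q S (c : R) : ~ Q `<< S ->
  exists2 g, bounded_measurable g & (c < dv_functional g S Q)%R.
Proof.
move=> nQS.
have [B [mB SB QB]] : exists B, [/\ measurable B, S B = 0 & Q B != 0].
  apply: contra_notP nQS => H; apply/null_content_dominatesP => B mB SB.
  by apply: contra_notP H => /eqP QB; exists B.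
have QBfin : Q B = (fine (Q B))%:E by rewrite fineK// fin_num_measure.
have QB0 : (0 < fine (Q B))%R.
  rewrite lt_neqAle fine_ge0// andbT eq_sym; apply: contra_neq QB => QB.
  by rewrite QBfin QB.
have b1 := @bounded_measurable_indic _ _ R _ mB.
have ind (m : {finite_measure set T -> \bar R}) :
    (\int[m]_x (\1_B x : R) = fine (m B))%R.
  by rewrite /Rintegral integral_indic// setIT.
pose t := ((`|c| + fine (S setT)) / fine (Q B))%R.
exists (fun x => t * \1_B x)%R; first exact: bounded_measurableZ.
rewrite /dv_functional bounded_RintegralZ//.
have -> : (\int[S]_x expR (t * \1_B x) = fine (S setT))%R.
  transitivity (\int[S]_x (1 + (expR t - 1) * \1_B x))%R.
    apply: eq_Rintegral => x _; rewrite indicE; case: (x \in B).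
      by rewrite !mulr1 addrC subrK.
    by rewrite !mulr0 expR0 addr0.
  rewrite bounded_RintegralD; [|exact: bounded_measurable_cst|exact: bounded_measurableZ].
  by rewrite bounded_RintegralZ// ind SB mulr0 addr0 Rintegral_cst// mul1r.
rewrite (ind (Q : {finite_measure set T -> \bar R})) /t divfK ?gt_eqF//.
have := ler_norm c; lra.
Qed.

Definition truncated_log (N : R) (y : \bar R) : R :=
  fine (maxe (- N)%:E (mine N%:E (lne y))).

Lemma truncated_log_bound (N : R) y : (0 <= N)%R -> (`|truncated_log N y| <= N)%R.
Proof.
move=> N0; rewrite /truncated_log.
have : (- N)%:E <= maxe (- N)%:E (mine N%:E (lne y)) <= N%:E.
  by rewrite le_max lexx/= ge_max ge_min lexx lee_fin/= andbT; lra.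
case: (maxe _ _) => [z| |]//=; first by rewrite !lee_fin ler_norml.
by rewrite andbC.
Qed.

Lemma measurable_truncated_log (N : R) (f : T -> \bar R) :
  measurable_fun setT f -> measurable_fun setT (fun x => truncated_log N (f x)).
Proof.
move=> mf.
have ml : measurable_fun setT (fun x => lne (f x)).
  by apply: measurableT_comp => //; exact: measurable_lne.
have mm : measurable_fun setT (fun x => maxe (- N)%:E (mine N%:E (lne (f x)))).
  by apply: measurable_maxe => //; exact: measurable_mine.
by apply: (measurableT_comp _ mm).
Qed.

Lemma expR_truncated_log (N y : R) : (0 <= N)%R -> (0 <= y)%R ->
  (expR (truncated_log N y%:E) <= y + expR (- N))%R.
Proof.
move=> N0; rewrite /truncated_log le_eqVlt => /predU1P[<-|y0].
  rewrite le0_lneNy// (min_r (leNye _)) (max_l (leNye _)) /=; lra.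
rewrite lne_EFin// -EFin_min -EFin_max /=.
have [H|H] := leP (- N)%R (Num.min N (ln y)).
  apply: (@le_trans _ _ y); last by rewrite lerDl expR_ge0.
  by rewrite -[leRHS](lnK y0) ler_expR ge_min lexx orbT.
by rewrite lerDr ltW.
Qed.

(** N is added to both sides to keep all terms nonnegative for integration. *)
Lemma truncated_log_lower (N : R) (y : \bar R) : (0 <= N)%R -> 0 <= y ->
  mine N%:E (maxe (lne y) 0) + N%:E <=
  (truncated_log N y + N)%:E + maxe (- lne y) 0.
Proof.
move=> N0; rewrite /truncated_log; case: (lne y) => [z| |] _.
- rewrite -?EFinN -!EFin_max -!EFin_min -?EFin_max -!EFinD lee_fin /=.
  have [z0|z0] := leP 0%R z.
    rewrite [Num.max (- z)%R 0%R]max_r ?oppr_le0// addr0 lerD2r.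
    by rewrite le_max lexx orbT.
  rewrite min_r// add0r [Num.max (- z)%R 0%R]max_l; last by rewrite oppr_ge0 ltW.
  have : (z <= Num.max (- N) (Num.min N z))%R.
    by rewrite [Num.min _ _]min_r ?le_max ?lexx ?orbT// (le_trans (ltW z0)).
  lra.
- rewrite /= (max_l (leey _)) (min_l (leey _)) -EFin_max max_r ?gtrN//=.
    by rewrite (max_r (leNye _)) adde0 -EFinD.
  lra.
- by rewrite /= (max_l (leey _)) addey// leey.
Qed.

Lemma ereal_mine_cvg (x : \bar R) : 0 <= x ->
  mine n%:R%:E x @[n --> \oo] --> x.
Proof.
case: x => [r| |]// r0.
  apply: cvg_near_cst; near=> n; rewrite min_r// lee_fin.
  by near: n; exact: nbhs_infty_ger.
apply/cvgeyPge => A; near=> n; rewrite min_l ?leey// lee_fin.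
by near: n; exact: nbhs_infty_ger.
Unshelve. all: by end_near. Qed.

(** Take g = log Y truncated to [-n, n].  Its integral under Q exceeds any bound
    below the entropy for large n by monotone convergence of the positive part,
    and e^g <= Y + e^(-n) gives an exponential moment close to Q(T) = 1. *)
Lemma dv_witness Q S (c : R) : c%:E < relent Q S ->
  exists2 g, bounded_measurable g & (c < dv_functional g S Q)%R.
Proof.
have [QS|nQS _] := pselect (Q `<< S); last exact: dv_witness_singular.
rewrite relentE// integralE.
have mY := measurable_density QS.
have mlY : measurable_fun setT (fun x => lne (density Q S x)).
  by apply: measurableT_comp => //; exact: measurable_lne.
have mp := measurable_funepos mlY; have mn := measurable_funeneg mlY.
have := integral_log_density_neg_lty QS.
set B := \int[Q]_x (_^\- x); set C := \int[Q]_x (_^\+ x) => By cCB.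
have B0 : 0 <= B by exact: integral_ge0.
have [c' cc' c'CB] := real_between cCB.
have [b bE] : exists b, B = b%:E.
  by exists (fine B); rewrite fineK// ge0_fin_numE.
have c'bC : (c' + b)%:E < C by move: c'CB; rewrite bE EFinD lteBrDr.
pose h n x := mine n%:R%:E ((fun x => lne (density Q S x))^\+ x).
have mh n : measurable_fun setT (h n) by exact: measurable_mine.
have h0 n x : 0 <= h n x by rewrite le_min lee_fin ler0n funepos_ge0.
have cvC : \int[Q]_x h n x @[n --> \oo] --> C.
  have -> : C = \int[Q]_x limn (h ^~ x).
    apply: eq_integral => x _; apply/esym/cvg_lim => //.
    exact: ereal_mine_cvg (funepos_ge0 _ x).
  apply: (@cvg_monotone_convergence _ _ _ Q setT measurableT h) => //.
  by move=> x _ m n mn'; rewrite /h le_min2// lee_fin ler_nat.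
have [n [n1 n2]] : exists n : nat, (c' + b)%:E < \int[Q]_x h n x /\
    (expR (- n%:R) * fine (S setT) < c' - c)%R.
  pose s := fine (S setT).
  have s0 : (0 <= s)%R by exact: fine_ge0.
  have [N _ NP] : \forall n \near \oo, (c' + b)%:E < \int[Q]_x h n x.
    apply: (cvC [set y | (c' + b)%:E < y]).
    by apply: open_nbhs_nbhs; split=> //; exact: open_ereal_gt_ereal.
  have cc : (0 < c' - c)%R by rewrite subr_gt0 -lte_fin.
  have [M _ MP] := @nbhs_infty_ger R (s / (c' - c))%R.
  exists (maxn N M); split; first by apply: NP; rewrite /= leq_maxl.
  rewrite expRN mulrC ltr_pdivrMr ?expR_gt0// mulrC -ltr_pdivrMr//.
  apply: (le_lt_trans (MP (maxn N M) (leq_maxr _ _))).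
  by apply: lt_le_trans (expR_ge1Dx _); rewrite ltrDr.
pose g x := truncated_log n%:R (density Q S x).
have bg : bounded_measurable g.
  split; first exact: measurable_truncated_log.
  by exists n%:R => x; exact: truncated_log_bound.
exists g => //.
have I1 : (c' < \int[Q]_x g x)%R.
  have bgn : bounded_measurable (fun x => g x + n%:R)%R.
    by apply: bounded_measurableD => //; exact: bounded_measurable_cst.
  have gn0 x : 0 <= (g x + n%:R)%:E.
    rewrite lee_fin; have := truncated_log_bound (density Q S x) (ler0n R n).
    by rewrite ler_norml => /andP[]; rewrite -/(g x); lra.
  have : \int[Q]_x (h n x + n%:R%:E) <=
      \int[Q]_x ((g x + n%:R)%:E + (fun x => lne (density Q S x))^\- x).
    apply: ge0_le_integral => //.
    - by move=> x _; rewrite adde_ge0// lee_fin.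
    - by apply: emeasurable_funD => //; exact: mh.
    - by apply: emeasurable_funD => //; apply/measurable_EFinP; case: bgn.
    move=> x _; rewrite /h funeposE funenegE.
    by apply: truncated_log_lower => //; exact: density_ge0.
  rewrite ge0_integralD//.
  rewrite ge0_integralD//; last by apply/measurable_EFinP; case: bgn.
  rewrite -/B bE (integral_cst _ measurableT) [X in _ * X](probability_setT Q) mule1.
  rewrite -(EFin_bounded_Rintegral _ bgn).
  rewrite bounded_RintegralD//; last exact: bounded_measurable_cst.
  rewrite Rintegral_cst// [X in fine X](probability_setT Q) mulr1.
  move=> H; have : (c' + b)%:E + n%:R%:E < (\int[Q]_x g x + n%:R)%R%:E + b%:E.
    by apply: lt_le_trans H; rewrite lteD2rE.
  by rewrite -!EFinD lte_fin; lra.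
have I2 : (\int[S]_x expR (g x) <= 1 + expR (- n%:R) * fine (S setT))%R.
  have Y1 : \int[S]_x density Q S x = 1.
    rewrite -(Radon_Nikodym_SigmaFinite.f_integral QS measurableT).
    exact: probability_setT.
  rewrite -lee_fin EFin_bounded_Rintegral; last exact: bounded_measurable_expR.
  apply: (@le_trans _ _ (\int[S]_x (density Q S x + (expR (- n%:R))%:E))).
    apply: ge0_le_integral => //.
    - by apply/measurable_EFinP; case: (bounded_measurable_expR bg).
    - exact: emeasurable_funD.
    move=> x _; rewrite /g densityK// -EFinD lee_fin expR_truncated_log//.
    by rewrite fine_ge0// density_ge0.
  rewrite ge0_integralD//.
  - rewrite Y1 integral_cst// EFinD EFinM fineK//; exact: fin_num_measure.
  - by move=> x _; exact: density_ge0.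
rewrite /dv_functional; lra.
Qed.

End variational_formula.

(** * Integrals against combinations of measures *)

Section combination_of_measures.
Context {d : measure_display} {T : measurableType d} {R : realType}.
Implicit Types (P Q S : {finite_measure set T -> \bar R}).

(** The measures only have to agree on measurable sets, as the representatives
    of mixtures provided by [convex_probs] do. *)
Lemma bounded_Rintegral_combination (a b : R) P Q S (f : T -> R) :
  0 <= a -> 0 <= b ->
  (forall B, measurable B -> S B = (a%:E * P B + b%:E * Q B)%E) ->
  bounded_measurable f ->
  \int[S]_x f x = a * \int[P]_x f x + b * \int[Q]_x f x.
Proof.
move=> a0 b0 SPQ.
have nng g : bounded_measurable g -> (forall x, 0 <= g x) ->
    \int[S]_x g x = a * \int[P]_x g x + b * \int[Q]_x g x.
  move=> bg g0; apply: EFin_inj; rewrite EFinD !EFinM !EFin_bounded_Rintegral//.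
  have mg : measurable_fun setT (EFin \o g) by apply/measurable_EFinP; case: bg.
  have g0' x : setT x -> (0 <= (g x)%:E)%E by rewrite lee_fin.
  rewrite -(ge0_integral_mscale P measurableT (NngNum a0) mg g0').
  rewrite -(ge0_integral_mscale Q measurableT (NngNum b0) mg g0').
  rewrite -ge0_integral_measure_add//.
  apply: eq_measure_integral => B mB _.
  transitivity (a%:E * P B + b%:E * Q B)%E; first exact: SPQ.
  exact: (esym (measure_addE (mscale (NngNum a0) P) (mscale (NngNum b0) Q) B)).
move=> bf; have [_ [M fM]] := bf.
have bM := @bounded_measurable_cst _ T R M.
have bfM := bounded_measurableD bf bM.
have f0 x : 0 <= f x + M by have := fM x; rewrite ler_norml => /andP[]; lra.
have M0 (x : T) : 0 <= M by rewrite (le_trans _ (fM x)).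
have := nng _ bfM f0; rewrite !bounded_RintegralD// !mulrDr.
move: (nng _ bM M0) => {M0}; lra.
Qed.

Lemma Rintegral_le_measure P Q (f : T -> R) : (forall B, measurable B -> (P B <= Q B)%E) ->
  bounded_measurable f -> (forall x, 0 <= f x) ->
  \int[P]_x f x <= \int[Q]_x f x.
Proof.
move=> PQ bf f0; rewrite -lee_fin !EFin_bounded_Rintegral//.
apply: (@ge0_le_measure_integral _ _ _ _ _ PQ) => //.
by apply/measurable_EFinP; case: bf.
Qed.

(** An alias of [measure_add] that carries the structure of a finite measure. *)
Definition sum_measure P Q : set T -> \bar R := measure_add P Q.

End combination_of_measures.

Section sum_measure_instance.
Context {d : measure_display} {T : measurableType d} {R : realType}.
Variables (P Q : {finite_measure set T -> \bar R}).

HB.instance Definition _ := Measure.on (sum_measure P Q).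

Let sum_measure_finite : fin_num_fun (sum_measure P Q).
Proof.
move=> B mB; rewrite /sum_measure measure_addE fin_numD.
by rewrite !fin_num_measure.
Qed.

HB.instance Definition _ :=
  @Measure_isFinite.Build _ _ _ (sum_measure P Q) sum_measure_finite.

Lemma Rintegral_sum_measure (f : T -> R) : bounded_measurable f ->
  \int[sum_measure P Q]_x f x = \int[P]_x f x + \int[Q]_x f x.
Proof.
move=> bf; rewrite (@bounded_Rintegral_combination _ _ _ 1 1 P Q (sum_measure P Q))//.
  by rewrite !mul1r.
by move=> B mB; rewrite !mul1e; exact: measure_addE.
Qed.

End sum_measure_instance.

(** * Continuous witnesses and topologies on probability measures *)

Section continuous_witness.
Context {R : realType} {Omega : ptopologicalType}.
Local Notation T := (borelType Omega).
Implicit Types (f g h : T -> R) (P Q S : {finite_measure set T -> \bar R}).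

Lemma bounded_continuous_expR f : bounded_continuous f ->
  bounded_continuous (fun x => expR (f x)).
Proof.
move=> [cf [M fM]]; split.
  move=> x; apply: (@continuous_comp Omega R R f expR x); first exact: cf.
  exact: continuous_expR.
exists (expR M) => x; rewrite ger0_norm ?expR_ge0// ler_expR.
exact: le_trans (ler_norm _) (fM x).
Qed.

Lemma expR_lipschitz (a b M : R) : a <= M -> b <= M ->
  `|expR a - expR b| <= expR M * `|a - b|.
Proof.
have H (u v : R) : v <= u -> u <= M -> `|expR u - expR v| <= expR M * `|u - v|.
  move=> vu uM; rewrite !ger0_norm ?subr_ge0 ?ler_expR//.
  have := expR_ge1Dx (v - u); rewrite expRD expRN.
  rewrite -(ler_pM2l (expR_gt0 u)) mulrCA mulfV ?gt_eqF ?expR_gt0// mulr1 => H.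
  have : expR u * (u - v) <= expR M * (u - v).
    by rewrite ler_wpM2r ?subr_ge0// ler_expR.
  lra.
move=> aM bM; have [ab|ab] := leP b a; first exact: H.
by rewrite distrC [X in _ <= _ * X]distrC; apply: H => //; exact: ltW.
Qed.

(** Approximation in L1 of P + Q serves both measures at once. *)
Lemma two_measure_approximation P Q h (a b e : R) : polish R Omega ->
  measurable_fun setT h -> (forall x, a <= h x <= b) -> 0 < e ->
  exists g, [/\ bounded_continuous g, forall x, a <= g x <= b,
    \int[P]_x `|h x - g x| <= e & \int[Q]_x `|h x - g x| <= e].
Proof.
move=> pO mh hab e0.
have [g [cg gab]] := L1_continuous_approximation (sum_measure P Q) pO mh hab e0.
rewrite Rintegral_sum_measure => [hg|]; last first.
  apply/bounded_measurable_norm/bounded_measurableB; last first.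
    exact: bounded_continuous_measurable.
  by split=> //; exists (Num.max `|a| `|b|) => x; exact: norm_le_max_itv.
exists g; split=> //; apply: le_trans hg; rewrite ?lerDl ?lerDr;
  by apply: Rintegral_ge0 => x _; exact: normr_ge0.
Qed.

Lemma continuous_dv_witness (Q : probability T R) S (c : R) : polish R Omega ->
  (c%:E < relent Q S)%E ->
  exists2 g, bounded_continuous g & c < dv_functional g S Q.
Proof.
move=> pO /dv_witness[h bh ch]; have [mh [M hM]] := bh.
have hMM x : - M <= h x <= M by rewrite -ler_norml.
pose e := (dv_functional h S Q - c) / (2 * (1 + expR M)).
have D0 : 0 < 2 * (1 + expR M) by have := expR_gt0 M; lra.
have e0 : 0 < e by rewrite divr_gt0// subr_gt0.
have eE : e * (2 * (1 + expR M)) = dv_functional h S Q - c.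
  by rewrite /e divfK// gt_eqF.
have [g [cg gMM gQ gS]] := two_measure_approximation Q S pO mh hMM e0.
exists g => //; have bg := bounded_continuous_measurable cg.
have := le_trans (bounded_Rintegral_dist Q bh bg) gQ.
have : `|\int[S]_x expR (h x) - \int[S]_x expR (g x)| <= expR M * e.
  have beh := bounded_measurable_expR bh; have beg := bounded_measurable_expR bg.
  have bhg : bounded_measurable (fun x => `|h x - g x|).
    exact/bounded_measurable_norm/bounded_measurableB.
  apply: le_trans (bounded_Rintegral_dist S beh beg) _.
  apply: (@le_trans _ _ (\int[S]_x (expR M * `|h x - g x|))).
    apply: bounded_Rintegral_le => [||x].
    - exact/bounded_measurable_norm/bounded_measurableB.
    - exact: bounded_measurableZ.
    - have /andP[_ h1] := hMM x; have /andP[_ g1] := gMM x.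
      exact: expR_lipschitz.
  by rewrite bounded_RintegralZ// ler_wpM2l// expR_ge0.
rewrite /dv_functional in eE *; rewrite !ler_norml => /andP[S1 S2] /andP[Q1 Q2].
move: eE S1 S2; rewrite [expR M * e]mulrC mulrCA mulrDr mulr1.
have : 0 < e * expR M by rewrite mulr_gt0// expR_gt0.
set K := e * expR M; lra.
Qed.

End continuous_witness.

Lemma continuous_funB (X : topologicalType) (R : realType) (u v : X -> R) :
  continuous u -> continuous v -> continuous (fun x => u x - v x).
Proof. by move=> cu cv x; apply: cvgB; [exact: cu|exact: cv]. Qed.

Section probs_topology_facts.
Context {d : measure_display} {T : measurableType d} {R : realType}.

Lemma continuous_probs_Rintegral (F : set (T -> R)) (f : T -> R) : F f ->
  continuous (fun P : probs_topology F => \int[(P : probability T R)]_x f x).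
Proof.
move=> Ff; pose i : F := SigSub (mem_set Ff).
pose ev (P : probs_topology F) : {ptws F -> R} :=
  fun f : F => Rintegral (P : probability T R) setT (set_val f).
have cev : continuous ev by exact: initial_continuous.
move=> P; apply: (@continuous_comp _ {ptws F -> R} R ev (fun u => u i) P).
  exact: cev.
exact: proj_continuous.
Qed.

Lemma convex_probs_Rintegral (A : set (probability T R)) P Q (t : R) :
  convex_probs A -> A P -> A Q -> 0 <= t <= 1 ->
  exists2 S, A S & forall f : T -> R, bounded_measurable f ->
    \int[S]_x f x = t * \int[P]_x f x + (1 - t) * \int[Q]_x f x.
Proof.
move=> cA AP AQ t01; have [S AS SE] := cA _ _ AP AQ _ t01.
exists S => // f bf; case/andP: t01 => t0 t1.
by apply: bounded_Rintegral_combination; rewrite ?subr_ge0.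
Qed.

End probs_topology_facts.

(** * The effective null and strong duality *)

Section duality.
Context {R : realType} {Omega : ptopologicalType}.
Local Notation T := (borelType Omega).
Local Notation M1 := (probability T R).
Local Notation Mp := {finite_measure set T -> \bar R}.
Local Notation weak := (probs_topology (bounded_continuous : set (T -> R))).
Implicit Types (PP QQ : set M1) (P Q : M1) (S : Mp) (f g : T -> R).

Lemma sol_sub_Peff PP S : sol PP S -> Peff PP S.
Proof.
move=> [P PPP SP] X [mX X0 XP]; apply: le_trans (XP _ PPP).
exact: (@ge0_le_measure_integral _ _ _ _ _ SP).
Qed.

(** Approximate the indicator of a set B with S(B) > P(B); the multiple 4/D of
    the approximation, D = S(B) - P(B), has a gap of at least 2 in expectation. *)
Lemma separating_function S P : polish R Omega ->
  ~ (forall B, measurable B -> (S B <= P B)%E) ->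
  exists f, [/\ bounded_continuous f, forall x, 0 <= f x &
    1 < \int[S]_x f x - \int[P]_x f x].
Proof.
move=> pO /existsNP[B /not_implyP[mB /negP]]; rewrite -ltNge => PS.
have ind (m : Mp) : \int[m]_x (\1_B x : R) = fine (m B).
  by rewrite /Rintegral integral_indic// setIT.
pose D := fine (S B) - fine (P B).
have D0 : 0 < D by rewrite subr_gt0 fine_lt// fin_num_measure.
have [f [cf f01 fS fP]] : exists f, [/\ bounded_continuous f,
    forall x, 0 <= f x <= 1,
    \int[S]_x `|\1_B x - f x| <= D / 4 & \int[P]_x `|\1_B x - f x| <= D / 4].
  have [mB1 _] := @bounded_measurable_indic _ T R _ mB.
  apply: (two_measure_approximation _ _ pO mB1); last by rewrite divr_gt0.
  by move=> x; rewrite indicE; case: (_ \in _); rewrite ?lexx ?ler01.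
have bf := bounded_continuous_measurable cf.
have bB := @bounded_measurable_indic _ T R _ mB.
exists (fun x => 4 / D * f x); split.
- exact: bounded_continuousZ.
- by move=> x; have /andP[f0 _] := f01 x; rewrite mulr_ge0// divr_ge0// ltW.
rewrite !bounded_RintegralZ//.
have := le_trans (bounded_Rintegral_dist S bB bf) fS.
have := le_trans (bounded_Rintegral_dist P bB bf) fP.
rewrite !ind !ler_norml => /andP[P1 P2] /andP[S1 S2].
have : D / 2 <= \int[S]_x f x - \int[P]_x f x by rewrite /D in P1 P2 S1 S2 *; lra.
rewrite -mulrBr -(ler_pM2l (_ : 0 < 4 / D)) ?divr_gt0// => H.
apply: lt_le_trans H.
by rewrite (_ : 4 / D * (D / 2) = 2) ?ltr1n//; field; rewrite gt_eqF.
Qed.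

Definition nonneg_bounded_continuous : set (T -> R) :=
  [set f | bounded_continuous f /\ forall x, 0 <= f x].

Lemma evariable_scaled PP f (K : R) : bounded_continuous f -> (forall x, 0 <= f x) ->
  0 < K -> (forall P, PP P -> \int[P]_x f x <= K) ->
  evariable PP (fun x => (K^-1 * f x)%:E).
Proof.
move=> cf f0 K0 fK; have bf := bounded_continuous_measurable cf.
have bKf := bounded_measurableZ K^-1 bf.
split.
- by apply/measurable_EFinP; case: bKf.
- by move=> x; rewrite lee_fin mulr_ge0// invr_ge0 ltW.
- move=> P PPP; rewrite -EFin_bounded_Rintegral// lee_fin bounded_RintegralZ//.
  by rewrite ler_pdivrMl// mulr1 fK.
Qed.

(** Normalizing the gap to 1 beforehand, as [separating_function] does, makes
    the uniform f of the minimax theorem satisfy E_P[f] <= E_S[f] - 1 for all P;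
    dividing by K = E_S[f] - 1/2 gives an e-variable with S-integral above 1. *)
Lemma Peff_sub_sol PP S : polish R Omega -> PP !=set0 -> convex_probs PP ->
  weakly_compact PP -> Peff PP S -> sol PP S.
Proof.
move=> pO [P0 PP0] cPP kPP eS; apply: contrapT => nsol.
have sep P : PP P -> exists2 f, nonneg_bounded_continuous f &
    1 < \int[S]_x f x - \int[P]_x f x.
  move=> PPP; have [|f [cf f0 fSP]] := @separating_function S P pO.
    by move=> SP; apply: nsol; exists P.
  by exists f.
have bm f : nonneg_bounded_continuous f -> bounded_measurable f.
  by move=> [cf _]; exact: bounded_continuous_measurable.
have [|||||f [cf f0] fSP] := @compact_minimax R weak _ nonneg_bounded_continuous
  (fun f (P : weak) => \int[S]_x f x - \int[(P : M1)]_x f x) 1 PP kPP.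
- move=> f [cf _].
  apply: (@continuous_funB weak); first exact: cst_continuous.
  exact: continuous_probs_Rintegral.
- move=> P Q PPP PPQ t t01.
  have [V PPV VE] := convex_probs_Rintegral cPP PPP PPQ t01.
  exists V => // f /bm bf; rewrite VE//; lra.
- move=> f g cf cg t /andP[t0 t1]; have bf := bm _ cf; have bg := bm _ cg.
  case: cf cg => [cf f0] [cg g0].
  exists (fun x => t * f x + (1 - t) * g x).
    split; first by apply: bounded_continuousD; exact: bounded_continuousZ.
    by move=> x; rewrite addr_ge0 ?mulr_ge0 ?subr_ge0.
  move=> P; rewrite !bounded_RintegralD; try exact: bounded_measurableZ.
  rewrite !bounded_RintegralZ//; lra.
- by exists (fun=> 0); split=> //; exact: bounded_continuous_cst.
- exact: sep.
pose K := \int[S]_x f x - 2^-1.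
have P0f : 0 <= \int[P0]_x f x by apply: Rintegral_ge0.
have K0 : 0 < K by have := fSP _ PP0; rewrite /K; lra.
have eX : evariable PP (fun x => (K^-1 * f x)%:E).
  apply: evariable_scaled => // P PPP; have := fSP _ PPP; rewrite /K; lra.
have bf : bounded_measurable f by exact: bm.
have := eS _ eX; rewrite -EFin_bounded_Rintegral; last exact: bounded_measurableZ.
rewrite bounded_RintegralZ// lee_fin ler_pdivrMl// mulr1 /K; lra.
Qed.

(** Immediate from the variational formula, since F(g; S, Q) is antitone in S. *)
Lemma relent_antitone (Q : M1) S1 S2 : (forall B, measurable B -> (S1 B <= S2 B)%E) ->
  (relent Q S2 <= relent Q S1)%E.
Proof.
move=> S12; rewrite leNgt; apply/negP => /real_between[c c1 c2].
have [g bg cg] := dv_witness c2; move: c1; apply/negP; rewrite -leNgt.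
apply: le_trans (dv_functional_le_relent Q S1 bg); rewrite lee_fin.
apply: (le_trans (ltW cg)); rewrite /dv_functional lerD2r lerD2l lerN2.
apply: Rintegral_le_measure => //; first exact: bounded_measurable_expR.
Qed.

Lemma sol_self PP P : PP P -> sol PP P.
Proof. by move=> PPP; exists P. Qed.

Lemma Peff_eq_sol PP : polish R Omega -> PP !=set0 -> convex_probs PP ->
  weakly_compact PP -> Peff PP = sol PP.
Proof.
move=> pO PP0 cPP kPP; apply/seteqP; split=> S.
  exact: Peff_sub_sol.
exact: sol_sub_Peff.
Qed.

Lemma min_relent_attained PP (Q : M1) : polish R Omega -> PP !=set0 ->
  weakly_compact PP -> is_minimum PP (fun P => relent Q P) (min_relent PP Q).
Proof.
move=> pO PP0 kPP; split; last first.
  by move=> P PPP; apply: ereal_inf_lbound; exists P.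
apply: (@compact_sup_attains_inf R weak _ bounded_continuous
  (fun g (P : weak) => dv_functional g (P : M1) Q)) => //.
- move=> g cg; rewrite /dv_functional.
  under eq_fun do rewrite addrAC.
  apply: (@continuous_funB weak); first exact: cst_continuous.
  by apply: continuous_probs_Rintegral; exact: bounded_continuous_expR.
- move=> g P cg _; apply: dv_functional_le_relent.
  exact: bounded_continuous_measurable.
- by move=> P c _; exact: continuous_dv_witness.
Qed.

Lemma min_relent_le_sol PP (Q : M1) S : sol PP S -> (min_relent PP Q <= relent Q S)%E.
Proof.
move=> [P PPP SP]; apply: (@le_trans _ _ (relent Q P)).
  by apply: ereal_inf_lbound; exists P.
exact: relent_antitone.
Qed.

Lemma inf_Elog_le_relent PP QQ X (Q : M1) S : evariable PP X -> Peff PP S -> QQ Q ->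
  (inf_Elog QQ X <= relent Q S)%E.
Proof.
move=> eX eS QQQ; have [mX X0 _] := eX.
apply: (@le_trans _ _ (Elog Q X)).
  by apply: ereal_inf_lbound; exists Q.
by apply: Elog_le_relent => //; exact: eS.
Qed.

Lemma G_le_relent PP QQ (Q : M1) S : Peff PP S -> QQ Q ->
  (G_val PP QQ <= relent Q S)%E.
Proof.
move=> eS QQQ; apply: ge_ereal_sup => _ [X eX <-].
exact: inf_Elog_le_relent eX eS QQQ.
Qed.

Lemma Gb_le_G PP QQ : (Gb_val PP QQ <= G_val PP QQ)%E.
Proof.
by apply: le_ereal_sup => _ [X [eX _] <-]; exists X.
Qed.

(** With K = sup_P E_P[e^g], the function e^g / K is a bounded e-variable and
    E_Q[g] - ln K >= E_Q[g] - K + 1 >= c. *)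
Lemma Gb_ge_dv_bound PP QQ g (c : R) :
  PP !=set0 -> QQ !=set0 -> bounded_continuous g ->
  (forall P Q, PP P -> QQ Q -> c <= dv_functional g P Q) ->
  (c%:E <= Gb_val PP QQ)%E.
Proof.
move=> [P0 PP0] [Q0 QQ0] cg cF.
have bg := bounded_continuous_measurable cg.
have ceg := bounded_continuous_expR cg.
have beg := bounded_continuous_measurable ceg.
pose A := [set \int[P]_x expR (g x) | P in PP].
have eA Q : QQ Q -> ubound A (\int[Q]_x g x + 1 - c).
  by move=> QQQ _ [P PPP <-]; have := cF P Q PPP QQQ; rewrite /dv_functional; lra.
have sA : has_sup A.
  by split; [exists (\int[P0]_x expR (g x)), P0|eexists; exact: eA QQ0].
pose K := sup A.
have PK P : PP P -> \int[P]_x expR (g x) <= K.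
  by move=> PPP; apply: ub_le_sup; [exact: sA.2|exists P].
have K0 : 0 < K.
  have [_ [M gM]] := cg.
  apply: lt_le_trans (PK _ PP0); apply: (@lt_le_trans _ _ (\int[P0]_x expR (- M))).
    rewrite Rintegral_cst// [X in fine X](probability_setT P0) mulr1.
    exact: expR_gt0.
  apply: bounded_Rintegral_le => //; first exact: bounded_measurable_cst.
  by move=> x; rewrite ler_expR; have := gM x; rewrite ler_norml => /andP[].
pose X x := (K^-1 * expR (g x))%:E.
have eX : evariable PP X by apply: evariable_scaled => // x; exact: expR_ge0.
have bX : bounded_evariable PP X.
  split=> //; have [_ [M gM]] := ceg; exists (K^-1 * M) => x.
  rewrite lee_fin ler_wpM2l ?invr_ge0 ?(ltW K0)//.
  exact: le_trans (ler_norm _) (gM x).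
apply: (@le_trans _ _ (inf_Elog QQ X)); last by apply: ereal_sup_ubound; exists X.
apply: le_ereal_inf_tmp => _ [Q QQQ <-].
rewrite Elog_exp ?invr_gt0// lee_fin lnV//.
have KQ : K <= \int[Q]_x g x + 1 - c by apply: ge_sup; [exact: sA.1|exact: eA].
have := @le_ln1Dx R (K - 1); rewrite addrCA subrr addr0.
rewrite ltrBrDl subrr => /(_ K0); lra.
Qed.

Local Notation setwise := (probs_topology (bounded_measurable : set (T -> R))).

Lemma continuous_dv_functional g : bounded_continuous g ->
  continuous (fun PQ : (weak * setwise)%type =>
    dv_functional g (PQ.1 : M1) (PQ.2 : M1)).
Proof.
move=> cg; have bg := bounded_continuous_measurable cg.
pose u (Q : setwise) := \int[(Q : M1)]_x g x.
pose v (P : weak) := \int[(P : M1)]_x expR (g x) - 1.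
have cu : continuous u by exact: continuous_probs_Rintegral.
have cv : continuous v.
  apply: (@continuous_funB weak); last exact: cst_continuous.
  by apply: continuous_probs_Rintegral; exact: bounded_continuous_expR.
rewrite (_ : (fun _ => _) = fun PQ : (weak * setwise)%type => u PQ.2 - v PQ.1).
  apply: (@continuous_funB (weak * setwise)%type) => PQ.
    apply: (@continuous_comp (weak * setwise)%type setwise R snd u PQ).
      exact: cvg_snd.
    exact: cu.
  apply: (@continuous_comp (weak * setwise)%type weak R fst v PQ).
    exact: cvg_fst.
  exact: cv.
by apply/funext => PQ; rewrite /dv_functional /u /v opprB addrA addrAC.
Qed.

Lemma expR_convex_le (a b t : R) : 0 <= t <= 1 ->
  expR (t * a + (1 - t) * b) <= t * expR a + (1 - t) * expR b.
Proof.
move=> /andP[t0 t1]; set m := t * a + (1 - t) * b.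
have H (u : R) : expR m * (1 + (u - m)) <= expR u.
  have := expR_ge1Dx (u - m); rewrite expRD expRN.
  rewrite -(ler_pM2l (expR_gt0 m)) [X in _ <= X -> _]mulrCA mulfV ?gt_eqF ?expR_gt0//.
  by rewrite mulr1.
have Ha := ler_wpM2l t0 (H a).
have t1' : 0 <= 1 - t by rewrite subr_ge0.
have Hb := ler_wpM2l t1' (H b).
apply: le_trans (lerD Ha Hb); rewrite le_eqVlt; apply/orP; left; apply/eqP.
rewrite /m; ring.
Qed.

(** A pair (P, Q) minimizes the relative entropy by compactness; if Gb were
    smaller than this minimum, a real c in between would lie below F(g; ., .)
    for some g depending on the point, hence for a common g by minimax. *)
Lemma strong_duality PP QQ : polish R Omega -> PP !=set0 -> convex_probs PP ->
  weakly_compact PP -> QQ !=set0 -> convex_probs QQ -> setwise_compact QQ ->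
  exists P Q, [/\ PP P, QQ Q & (relent Q P <= Gb_val PP QQ)%E].
Proof.
move=> pO PP0 cPP kPP QQ0 cQQ kQQ.
pose K : set (weak * setwise)%type := PP `*` QQ.
have cK : compact K by exact: compact_setX.
pose F g (PQ : (weak * setwise)%type) := dv_functional g (PQ.1 : M1) (PQ.2 : M1).
pose H (PQ : (weak * setwise)%type) := relent (PQ.2 : M1) (PQ.1 : M1).
have [||||[P Q] [/= PPP QQQ] Hinf] :=
  @compact_sup_attains_inf R (weak * setwise)%type _ bounded_continuous F H K cK.
- by case: PP0 QQ0 => P PPP [Q QQQ]; exists (P, Q).
- exact: continuous_dv_functional.
- move=> g PQ cg _; apply: dv_functional_le_relent.
  exact: bounded_continuous_measurable.
- by move=> PQ c _; exact: continuous_dv_witness.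
exists P, Q; split=> //; rewrite leNgt; apply/negP => /real_between[c Gc cPQ].
have [|||||g cg cF] := @compact_minimax R (weak * setwise)%type _ bounded_continuous F c K cK.
- exact: continuous_dv_functional.
- move=> [P1 Q1] [P2 Q2] [/= PP1 QQ1] [/= PP2 QQ2] t t01.
  have [P3 PP3 P3E] := convex_probs_Rintegral cPP PP1 PP2 t01.
  have [Q3 QQ3 Q3E] := convex_probs_Rintegral cQQ QQ1 QQ2 t01.
  exists (P3, Q3) => // g cg; have bg := bounded_continuous_measurable cg.
  rewrite /F /dv_functional/= P3E ?Q3E//; last exact: bounded_measurable_expR.
  lra.
- move=> g h cg ch t t01; have /andP[t0 t1] := t01.
  have cgh : bounded_continuous (fun x => t * g x + (1 - t) * h x).
    by apply: bounded_continuousD; exact: bounded_continuousZ.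
  exists (fun x => t * g x + (1 - t) * h x) => // -[P1 Q1].
  have bg := bounded_continuous_measurable cg.
  have bh := bounded_continuous_measurable ch.
  have beg := bounded_measurable_expR bg; have beh := bounded_measurable_expR bh.
  have bgh := bounded_continuous_measurable cgh.
  have : \int[P1]_x expR (t * g x + (1 - t) * h x) <=
      t * \int[P1]_x expR (g x) + (1 - t) * \int[P1]_x expR (h x).
    rewrite -!bounded_RintegralZ// -bounded_RintegralD; try exact: bounded_measurableZ.
    apply: bounded_Rintegral_le => [||x]; last exact: expR_convex_le.
      exact: bounded_measurable_expR.
    by apply: bounded_measurableD; exact: bounded_measurableZ.
  rewrite /F /dv_functional/=.
  rewrite (bounded_RintegralD Q1 (bounded_measurableZ t bg) (bounded_measurableZ (1 - t) bh)).
  rewrite !bounded_RintegralZ//; lra.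
- by exists (fun=> 0); exact: bounded_continuous_cst.
- move=> PQ KPQ; apply: continuous_dv_witness => //; apply: lt_le_trans cPQ _.
  by rewrite (Hinf : relent Q P = _); apply: ereal_inf_lbound; exists PQ.
move: Gc; apply/negP; rewrite -leNgt.
by apply: (Gb_ge_dv_bound PP0 QQ0 cg) => P1 Q1 ? ?; exact: (cF (P1, Q1)).
Qed.

End duality.

(** * Information projections *)

Section projections.
Context {d : measure_display} {T : measurableType d} {R : realType}.
Local Notation M1 := (probability T R).
Local Notation Mp := {finite_measure set T -> \bar R}.
Implicit Types (QQ : set M1) (P Q : M1) (S : Mp).

(** Replacing g by g + ln k in the variational formula. *)
Lemma relent_scale_le (Q : M1) S1 S2 (k : R) : 0 < k ->
  (forall B, measurable B -> S2 B = (k%:E * S1 B)%E) ->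
  (relent Q S2 <= relent Q S1 - (ln k)%:E)%E.
Proof.
move=> k0 S12; rewrite leNgt; apply/negP => /real_between[c c1 c2].
have [g bg cg] := dv_witness c2.
have bgk : bounded_measurable (fun x => g x + ln k).
  by apply: bounded_measurableD => //; exact: bounded_measurable_cst.
have beg := bounded_measurable_expR bg.
have := dv_functional_le_relent Q S1 bgk.
rewrite /dv_functional bounded_RintegralD//; last exact: bounded_measurable_cst.
rewrite Rintegral_cst// [X in fine X](probability_setT Q) mulr1.
have -> : \int[S1]_x expR (g x + ln k) = \int[S2]_x expR (g x).
  rewrite (@bounded_Rintegral_combination _ _ _ k 0 S1 S1 S2)//; last first.
  - by move=> B mB; rewrite mul0e adde0 S12.
  - exact: ltW.
  rewrite mul0r addr0 -bounded_RintegralZ//; apply: eq_Rintegral => x _.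
  by rewrite expRD lnK// mulrC.
move: cg c1; rewrite /dv_functional lteBlDr// -EFinD => cg c1 /le_lt_trans => /(_ _ c1).
rewrite lte_fin; lra.
Qed.

Lemma relent_lower_bound (Q : M1) S : ((1 - fine (S setT))%:E <= relent Q S)%E.
Proof.
apply: le_trans (dv_functional_le_relent Q S (bounded_measurable_cst 0)).
rewrite lee_fin /dv_functional expR0 !Rintegral_cst// mul0r mul1r; lra.
Qed.

(** From e^u <= 1 / (1 - u). *)
Lemma expR_quadratic (u : R) : u <= 2^-1 -> expR u <= 1 + u + 2 * u ^+ 2.
Proof.
move=> u2; have u1 : 0 < 1 - u by lra.
have : 1 - u <= expR (- u) by exact: expR_ge1Dx.
rewrite expRN -(ler_pM2r (expR_gt0 u)) mulVf ?gt_eqF ?expR_gt0// => eu.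
rewrite -(ler_pM2l u1); apply: (le_trans eu).
have -> : (1 - u) * (1 + u + 2 * u ^+ 2) = 1 + u ^+ 2 * (1 - 2 * u) by ring.
by rewrite lerDl mulr_ge0 ?sqr_ge0//; lra.
Qed.

(** If a minimizing Q has H(Q | P) < inf + n, the Pythagorean inequality gives
    H(Q | Q') < n, and the variational formula for H(Q | Q') at -t g bounds
    E_Q'[g] - E_Q[g] by n / t + 2 t M^2.  So F(g; P, Q') exceeds
    F(g; P, Q) <= H(Q | P) by little, for every bounded g. *)
Lemma GIPr_prob_relent_le QQ P Q' : is_GIPr_prob QQ P Q' ->
  (relent Q' P <= inf_relent QQ P)%E.
Proof.
move=> [h_fin pyth]; set h := inf_relent QQ P in h_fin pyth *.
have h0 : (0 <= h)%E.
  apply: le_ereal_inf_tmp => _ [Q _ <-]; apply: le_trans (relent_lower_bound Q P).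
  by rewrite [X in fine X](probability_setT P) subrr.
have [r hE] : exists r, h = r%:E by exists (fine h); rewrite fineK// ge0_fin_numE.
rewrite leNgt hE; apply/negP => /real_between[c rc cQ'].
have [g bg cg] := dv_witness cQ'; have [mg [M gM]] := bg.
have M0 : 0 <= M by rewrite (le_trans _ (gM point)).
rewrite lte_fin in rc.
pose e := (c - r) / 3; have e0 : 0 < e by rewrite divr_gt0// subr_gt0.
(* t makes the quadratic error at most e, and then an accuracy n <= e t makes
   n / t at most e; the three errors together stay below c - r = 3 e *)
pose t := Num.min (e / (2 * (M ^+ 2 + 1))) (1 / (2 * (M + 1))).
have M20 : 0 <= M ^+ 2 by exact: sqr_ge0.
have M21 : 0 < 2 * (M ^+ 2 + 1) by lra.
have M11 : 0 < 2 * (M + 1) by lra.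
have t0 : 0 < t by rewrite lt_min; apply/andP; split; rewrite divr_gt0.
have tM : t * M <= 2^-1.
  have : t <= 1 / (2 * (M + 1)) by rewrite ge_min lexx orbT.
  rewrite ler_pdivlMr// mulrCA mulrDr mulr1; lra.
have tM2 : 2 * (t * M ^+ 2) <= e.
  have : t <= e / (2 * (M ^+ 2 + 1)) by rewrite ge_min lexx.
  rewrite ler_pdivlMr// mulrCA mulrDr mulr1; lra.
pose n := Num.min e (e * t); have n0 : 0 < n by rewrite lt_min e0 mulr_gt0.
have [_ [Q QQQ <-] Qr] : exists2 x, [set relent Q P | Q in QQ] x & (x < (r + n)%:E)%E.
  apply/exists2P/not_existsP => H.
  have : ((r + n)%:E <= h)%E.
    apply: le_ereal_inf_tmp => x Ax; rewrite leNgt; apply/negP => xr.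
    by apply: (H x).
  by rewrite hE lee_fin; lra.
have QQ' : (relent Q Q' < n%:E)%E.
  have := le_lt_trans (pyth Q QQQ) Qr; rewrite hE addrC EFinD.
  by rewrite lteD2lE.
have btg : bounded_measurable (fun x => - t * g x) by exact: bounded_measurableZ.
have btg2 : bounded_measurable (fun x => t * g x) by exact: bounded_measurableZ.
have b1 := @bounded_measurable_cst _ T R (1 + 2 * (t * M) ^+ 2).
have Ee : \int[Q']_x expR (- t * g x) <= 1 + 2 * (t * M) ^+ 2 - t * \int[Q']_x g x.
  rewrite -bounded_RintegralZ//.
  have -> : 1 + 2 * (t * M) ^+ 2 = \int[Q']_x (1 + 2 * (t * M) ^+ 2).
    by rewrite Rintegral_cst// [X in fine X](probability_setT Q') mulr1.
  rewrite -bounded_RintegralB//; apply: bounded_Rintegral_le => [||x].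
  - exact: bounded_measurable_expR.
  - exact: bounded_measurableB.
  have tg : `|- t * g x| <= t * M.
    by rewrite normrM normrN (gtr0_norm t0) ler_pM2l.
  apply: le_trans (expR_quadratic (le_trans (ler_norm _) (le_trans tg tM))) _.
  have : (- t * g x) ^+ 2 <= (t * M) ^+ 2.
    by rewrite -real_normK ?num_real// ler_pXn2r ?nnegrE// mulr_ge0// ltW.
  lra.
have := le_lt_trans (dv_functional_le_relent Q Q' btg) QQ'.
rewrite lte_fin /dv_functional bounded_RintegralZ// => H1.
have := le_lt_trans (dv_functional_le_relent Q P bg) Qr.
rewrite lte_fin => H2.
have ne : n <= e by rewrite ge_min lexx.
have nte : n <= e * t by rewrite ge_min lexx orbT.
have H3 : t * (\int[Q']_x g x - \int[Q]_x g x) <= t * (e + e).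
  have : 2 * (t * M) ^+ 2 <= t * e.
    by rewrite exprMn [t ^+ 2]expr2 -mulrA mulrCA ler_pM2l.
  lra.
rewrite ler_pM2l// in H3.
have e3 : c - r = 3 * e by rewrite /e; field.
move: cg H2; rewrite /dv_functional; lra.
Qed.

(** Normalizing S shifts H(. | S) by a constant, hence its infimum as well. *)
Lemma GIPr_relent_le QQ S Q' : is_GIPr QQ S Q' ->
  (relent Q' S <= inf_relent QQ S)%E.
Proof.
move=> [S0 gip].
pose s := fine (S setT); have Sfin : S setT = s%:E by rewrite fineK// fin_num_measure.
have s0 : 0 < s by rewrite -lte_fin -Sfin.
set P := mnormalize S point in gip.
have PS B : measurable B -> P B = ((s^-1)%:E * S B)%E.
  move=> mB; rewrite /P /= /mnormalize; case: ifPn => [|_]; last exact: muleC.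
  have /eqP S1 : S setT != 0%E by rewrite gt_eqF.
  have /eqP S2 : S setT != +oo%E by rewrite Sfin.
  by case/orP => /eqP.
have SP B : measurable B -> S B = (s%:E * P B)%E.
  by move=> mB; rewrite PS// muleA -EFinM mulfV ?gt_eqF// mul1e.
have le1 := relent_scale_le Q' s0 SP.
apply: (le_trans le1); rewrite leeBlDr//.
apply: (le_trans (GIPr_prob_relent_le gip)).
rewrite -leeBlDr//; apply: le_ereal_inf_tmp => _ [Q QQQ <-].
rewrite leeBlDr//.
apply: (@le_trans _ _ (relent Q P)); first by apply: ereal_inf_lbound; exists Q.
apply: le_trans (relent_scale_le Q _ PS) _; first by rewrite invr_gt0.
by rewrite lnV// EFinN oppeK.
Qed.

End projections.

(** * Uniqueness of log-optimal e-variables *)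

Section uniqueness.
Context {d : measure_display} {T : measurableType d} {R : realType}.
Local Notation M1 := (probability T R).
Local Notation Mp := {finite_measure set T -> \bar R}.
Implicit Types (PP QQ : set M1) (P Q : M1) (S : Mp).
Local Open Scope ereal_scope.

(** For a >= 0 the condition a < 1/X reads X < 1/a, and for a < 0 it always
    holds. *)
Lemma measurable_inve_ge0 (X : T -> \bar R) : measurable_fun setT X ->
  (forall x, 0 <= X x) -> measurable_fun setT (fun x => (X x)^-1).
Proof.
move=> mX X0; apply: (measurability _ (ErealGenOInfty.measurableE R)).
move=> _ [_ [a ->] <-]; rewrite setTI.
have [a0|a0] := leP 0%R a.
  rewrite (_ : _ @^-1` _ = setT `&` X @^-1` `]-oo, (a%:E)^-1[%classic).
    by apply: mX => //; exact: emeasurable_itv.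
  apply/seteqP; split=> x /=; rewrite !in_itv/= andbT.
    by rewrite inve_pgt ?inE ?lee_fin ?X0//; split.
  by rewrite inve_pgt ?inE ?lee_fin ?X0// => -[].
rewrite (_ : _ @^-1` _ = setT)//; apply/seteqP; split=> x //= _.
by rewrite in_itv/= andbT (@lt_le_trans _ _ 0)// inve_ge0.
Qed.

Lemma RIPr_dominated PP Q S : is_RIPr PP Q S -> S `<< Q.
Proof.
move=> [X [[mX X0 _] _ _] SE]; apply/null_content_dominatesP => B mB QB.
rewrite SE//; apply: null_set_integral => //.
exact/measurable_funTS/measurable_inve_ge0.
Qed.

(** The remainder in weak duality must integrate to zero, so X/Y = 1 almost
    surely. *)
Lemma log_optimal_unique (Q : M1) S (X : T -> \bar R) :
  Q `<< S -> measurable_fun setT X -> (forall x, 0 <= X x) ->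
  \int[S]_x X x <= 1 -> relent Q S \is a fin_num -> relent Q S <= Elog Q X ->
  ae_eq Q setT X (density Q S).
Proof.
move=> QS mX X0 X1 Hfin HX.
have := log_duality QS mX X0 X1.
set I := \int[Q]_x _ => HI.
have mW : measurable_fun setT (fun x => X x * (recip_density Q S x)%:E).
  apply: emeasurable_funM => //; apply/measurable_EFinP.
  exact: measurable_recip_density.
have mI : measurable_fun setT (fun x => (log_slack (fine (X x * (recip_density Q S x)%:E)))%:E).
  exact: measurable_log_slack.
have I0 : I = 0.
  have Ige : 0 <= I by apply: integral_ge0 => x _; rewrite lee_fin sqr_ge0.
  apply/eqP; rewrite eq_le Ige andbT.
  move: Hfin HX HI Ige; rewrite /=; case: (relent Q S) => [h| |]//= _.
  case: (Elog Q X) => [e| |]//; case: I => [i| |]//=.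
  by rewrite -EFinD !lee_fin => ? ? ?; lra.
have /(ae_eq_integral_abs Q measurableT mI) ae0 :
    \int[Q]_x `|(log_slack (fine (X x * (recip_density Q S x)%:E)))%:E| = 0.
  rewrite -[RHS]I0; apply: eq_integral => x _.
  by rewrite gee0_abs// lee_fin sqr_ge0.
move: ae0 (density_gt0 QS); apply: filterS2 => x /(_ Logic.I)/= + Y0 _.
move=> -[/eqP]; rewrite /log_slack sqrf_eq0 subr_eq0 => /eqP s1.
have w0 : (0 <= fine (X x * (recip_density Q S x)%:E))%R.
  by rewrite fine_ge0// mule_ge0// lee_fin expR_ge0.
have := sqr_sqrtr w0; rewrite s1 expr1n; move: Y0.
rewrite /recip_density [in X in X -> _]densityK// lte_fin => y0.
case: (X x) (X0 x) => [z| |]//= _; last first.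
  by rewrite mulyr gtr0_sg ?expR_gt0// mul1e /= => /eqP; rewrite oner_eq0.
rewrite expRN lnK ?posrE// => z1.
rewrite [RHS]densityK//; congr EFin.
by rewrite -[LHS]mulr1 -(mulVf (lt0r_neq0 y0)) mulrA -z1 mul1r.
Qed.

End uniqueness.

(** * Duality for GROW e-variables *)

Section main_results.
Context {R : realType} {Omega : ptopologicalType}.
Local Notation T := (borelType Omega).
Local Notation M1 := (probability T R).
Local Notation Mp := {finite_measure set T -> \bar R}.
Implicit Types (PP QQ : set M1) (P Q : M1) (S : Mp).
Local Open Scope ereal_scope.

Lemma min_relent_Peff PP Q : polish R Omega -> PP !=set0 -> convex_probs PP ->
  weakly_compact PP -> is_minimum (Peff PP) (relent Q) (min_relent PP Q).
Proof.
move=> pO PP0 cPP kPP; rewrite (Peff_eq_sol pO PP0 cPP kPP).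
have [[P PPP PE] _] := min_relent_attained Q pO PP0 kPP.
split; first by exists P => //; exact: sol_self.
by move=> S; exact: min_relent_le_sol.
Qed.

Lemma GROW_duality PP QQ S X : Peff PP = sol PP -> Peff PP S -> evariable PP X ->
  (forall Q, QQ Q -> inf_relent QQ S <= Elog Q X) ->
  [/\ is_GROW PP QQ X, G_val PP QQ = inf_Elog QQ X,
     inf_Elog QQ X = inf_relent QQ S &
     inf_relent QQ S = ereal_inf [set min_relent PP Q | Q in QQ]].
Proof.
move=> Psol eS eX hX.
have h1 : inf_relent QQ S <= inf_Elog QQ X.
  by apply: le_ereal_inf_tmp => _ [Q QQQ <-]; exact: hX.
have h2 : inf_Elog QQ X <= G_val PP QQ by apply: ereal_sup_ubound; exists X.
have h3 : G_val PP QQ <= ereal_inf [set min_relent PP Q | Q in QQ].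
  apply: le_ereal_inf_tmp => _ [Q QQQ <-].
  apply: le_ereal_inf_tmp => _ [P PPP <-].
  by apply: G_le_relent => //; rewrite Psol; exact: sol_self.
have h4 : ereal_inf [set min_relent PP Q | Q in QQ] <= inf_relent QQ S.
  apply: le_ereal_inf_tmp => _ [Q QQQ <-].
  apply: (@le_trans _ _ (min_relent PP Q)).
    by apply: ereal_inf_lbound; exists Q.
  by apply: min_relent_le_sol; rewrite -Psol.
have GE : G_val PP QQ = inf_Elog QQ X.
  by apply/eqP; rewrite eq_le h2 andbT (le_trans h3)// (le_trans h4).
split=> //; apply/eqP; rewrite eq_le.
- by rewrite h1 -GE (le_trans h3).
- by rewrite h4 andbT (le_trans h1)// -GE.
Qed.

Lemma inf_relent_fin_num QQ S : inf_relent QQ S < +oo ->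
  inf_relent QQ S \is a fin_num.
Proof.
move=> hy; rewrite fin_numE (lt_eqF hy) andbT gt_eqF//.
apply: (@lt_le_trans _ _ (1 - fine (S setT))%:E); first exact: ltNyr.
by apply: le_ereal_inf_tmp => _ [Q _ <-]; exact: relent_lower_bound.
Qed.

(** The inequality H(Q | S) <= inf H <= G <= E_Q[log X] makes X log-optimal for
    Q, so X is the density Q-almost surely; this transfers to S, which has a
    density with respect to Q as its reverse information projection. *)
Lemma GROW_unique PP QQ S Q X Xs : joint_projection PP QQ S Q ->
  is_density_version Q S Xs -> QQ Q -> inf_relent QQ S <= G_val PP QQ ->
  is_GROW PP QQ X -> ae_eq S setT X Xs.
Proof.
move=> [eS ripr hy _ gipr] [_ _ Xsv] QQQ hG [eX XG]; have [mX X0 _] := eX.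
have hfin := inf_relent_fin_num hy.
have le1 := GIPr_relent_le gipr.
have QS : Q `<< S.
  apply: contrapT => /relent_not_dominated Qy.
  by move: (le_lt_trans le1 hy); rewrite Qy ltxx.
have Hh : relent Q S = inf_relent QQ S.
  by apply/eqP; rewrite eq_le le1 ereal_inf_lbound//; exists Q.
have XY : ae_eq Q setT X (density Q S).
  apply: log_optimal_unique => //; first exact: eS.
    by rewrite Hh.
  rewrite Hh (le_trans hG)// -XG.
  by apply: ereal_inf_lbound; exists Q.
apply: ae_eq_trans (null_dominates_ae_eq measurableT (RIPr_dominated ripr) XY) _.
apply: ae_eq_sym; apply: ae_eq_trans Xsv _; apply: ae_eq_sym.
exact: ae_eq_Radon_Nikodym_SigmaFinite.
Qed.

Lemma setwise_compact_duality PP QQ : polish R Omega -> PP !=set0 ->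
  convex_probs PP -> weakly_compact PP -> QQ !=set0 -> convex_probs QQ ->
  setwise_compact QQ ->
  G_val PP QQ = Gb_val PP QQ /\
  is_minimum QQ (min_relent PP) (G_val PP QQ).
Proof.
move=> pO PP0 cPP kPP QQ0 cQQ kQQ.
have [P [Q [PPP QQQ PQ]]] := strong_duality pO PP0 cPP kPP QQ0 cQQ kQQ.
have Gle Q' : QQ Q' -> G_val PP QQ <= min_relent PP Q'.
  move=> QQ'; apply: le_ereal_inf_tmp => _ [P' PPP' <-].
  by apply: G_le_relent => //; apply: sol_sub_Peff; exact: sol_self.
have mP : min_relent PP Q <= relent Q P by apply: ereal_inf_lbound; exists P.
have GGb : G_val PP QQ = Gb_val PP QQ.
  by apply/eqP; rewrite eq_le Gb_le_G andbT (le_trans (Gle _ QQQ))// (le_trans mP).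
split=> //; split=> //; exists Q => //.
by apply/eqP; rewrite eq_le Gle// andbT GGb (le_trans mP).
Qed.

End main_results.

Local Open Scope ereal_scope.
Unset Implicit Arguments.
Set Strict Implicit.
Set Printing Implicit Defensive.

Theorem proposition4p18 (R : realType) (Omega : ptopologicalType)
    (PP : set (probability (borelType Omega) R)) :
  polish R Omega -> PP !=set0 -> convex_probs PP -> weakly_compact PP ->
  [/\ Peff PP = sol PP,
      (forall Q : probability (borelType Omega) R,
         is_minimum (Peff PP) (relent Q) (min_relent PP Q) /\
         is_minimum PP (fun P => relent Q P) (min_relent PP Q)) &
      forall QQ : set (probability (borelType Omega) R),
        QQ !=set0 -> convex_probs QQ ->
        (forall (Pstar : {finite_measure set (borelType Omega) -> \bar R})
                (Qstar : probability (borelType Omega) R)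
                (Xstar : borelType Omega -> \bar R),
           joint_projection PP QQ Pstar Qstar ->
           is_density_version Qstar Pstar Xstar ->
           evariable PP Xstar ->
           (forall Q, QQ Q -> inf_relent QQ Pstar <= Elog Q Xstar) ->
           [/\ is_GROW PP QQ Xstar,
               G_val PP QQ = inf_Elog QQ Xstar,
               inf_Elog QQ Xstar = inf_relent QQ Pstar,
               inf_relent QQ Pstar = ereal_inf [set min_relent PP Q | Q in QQ] &
               QQ Qstar ->
               forall X, is_GROW PP QQ X -> ae_eq Pstar setT X Xstar]) /\
        (setwise_compact QQ ->
           G_val PP QQ = Gb_val PP QQ /\
           is_minimum QQ (min_relent PP) (G_val PP QQ))].
Proof.
move=> pO PP0 cPP kPP; have Psol := Peff_eq_sol pO PP0 cPP kPP.
split=> // [Q|QQ QQ0 cQQ].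
  by split; [exact: min_relent_Peff|exact: min_relent_attained].
split; last exact: setwise_compact_duality.
move=> Pstar Qstar Xstar jp dv eX hX; have [eS _ _ _ _] := jp.
have [gX GX Xh hm] := GROW_duality Psol eS eX hX.
split=> // QQstar X; apply: GROW_unique jp dv QQstar _.
by rewrite GX Xh.
Qed.
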